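(* Let $c\ge 2$ be an integer and suppose that every agent $i\in N$ has a $\{1,c\}$-SUB valuation $v_i$. The Bivalued Yankee Swap algorithm, run with the gain function $$\phi(X,i,d)=-(c+1)\,v_i(X_i)+d,$$ computes a leximin allocation, i.e. an allocation $X$ such that for no allocation $Y$ does the sorted utility vector $\vec s^{Y}$ lexicographically dominate $\vec s^{X}$.
   Context: **Setting.** $N=\{1,\dots,n\}$ is a set of agents and $G$ a finite set of $m$ goods. Write $S+g=S\cup\{g\}$, $S-g=S\setminus\{g\}$, $N+0=N\cup\{0\}$. For $v:2^G\to\mathbb{R}_{\ge0}$ let $\Delta_v(S,g)=v(S+g)-v(S)$. $v$ is $\{1,c\}$-SUB if $v(\emptyset)=0$; $\Delta_v(S,g)\in\{1,c\}$ for all $S\subseteq G$, $g\in G\setminus S$; and $\Delta_v(S,g)\ge\Delta_v(T,g)$ for all $S\subseteq T\subseteq G$, $g\in G\setminus T$. An allocation $X=(X_0,X_1,\dots,X_n)$ is a partition of $G$ into $n+1$ (possibly empty) bundles; $X_i$ goes to agent $i\in N$ and $X_0$ is unallocated. The sorted utility vector $\vec s^X$ is $(v_1(X_1),\dots,v_n(X_n))$ sorted in ascending order. $\vec y$ lexicographically dominates $\vec z$ if there is $k\in[n]$ with $y_j=z_j$ for all $j<k$ and $y_k>z_k$. **Clean allocations and exchange graph.** The dummy agent $0$ has valuation $v_0(S)=c|S|$. For $i\in N+0$ let $\beta_i(S)=\max\{|T|:T\subseteq S,\ v_i(T)=c|T|\}$. An allocation $X$ is clean if $\beta_i(X_i)=|X_i|$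 for all $i\in N+0$. For a clean allocation $X$, the exchange graph $\mathcal G(X)$ is the directed graph on $G$ with an edge $g\to g'$ if $g\in X_j$ and $\beta_j(X_j-g+g')=\beta_j(X_j)$ for some $j\in N+0$. $F_i(X)=\{g\in G:\beta_i(X_i+g)-\beta_i(X_i)=1\}$. For a clean allocation $X^c$ and a tuple $X^1=(X^1_1,\dots,X^1_n)$ of disjoint subsets of $X^c_0$, $X^c\cup X^1$ denotes the allocation giving $X^c_i\cup X^1_i$ to each $i\in N$ and leaving the rest unallocated. **Bivalued Yankee Swap with gain function $\phi$.** Initialize $X^c=(G,\emptyset,\dots,\emptyset)$, $X^1=(\emptyset,\dots,\emptyset)$, $U=N$. While $\sum_{h\in N}|X^1_h|<|X^c_0|$, perform one iteration: let $\mathrm{Gain}_c=\max_{k\in U}\phi(X^c\cup X^1,k,c)$ ($-\infty$ if $U=\emptyset$) and $\mathrm{Gain}_1=\max_{k\in N\setminus U}\phi(X^c\cup X^1,k,1)$ ($-\infty$ if $N\setminus U=\emptyset$). - If $\mathrm{Gain}_c\ge\mathrm{Gain}_1$: choose the smallest-index $i\in U$ attaining $\mathrm{Gain}_c$. If there is a path in $\mathcal G(X^c)$ from $F_i(X^c)$ to $X^c_0$, take a shortest such path $(g'_1,\dots,g'_t)$ and update $X^c$ by moving $g'_{s+1}$ to the bundle that contained $g'_s$ for $1\le s<t$, and moving $g'_1$ to $X^c_i$ (so $g'_t$ leaves $X^c_0$); if $g'_t\in X^1_j$ for some $j\in N$, replace $X^1_j$ by $X^1_j-g'_t+g$ for an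 arbitrary $g\in X^c_0\setminus\bigcup_{h\in N}X^1_h$. If no such path exists, remove $i$ from $U$. - If $\mathrm{Gain}_c<\mathrm{Gain}_1$: choose the smallest-index $i\in N\setminus U$ attaining $\mathrm{Gain}_1$ and add to $X^1_i$ an arbitrary $g\in X^c_0\setminus\bigcup_{h\in N}X^1_h$. When the loop ends, output $X^c\cup X^1$. *)

(* Defs.v *)
From mathcomp Require Import all_boot all_order all_algebra.
From mathcomp Require Import reals constructive_ereal.
Set Implicit Arguments.
Unset Strict Implicit.
Unset Printing Implicit Defensive.
Import Order.TTheory GRing.Theory Num.Theory.

Local Open Scope ring_scope.

Section Valuations.
Context {R : realType} {G : finType}.
Implicit Types (w : {set G} -> R) (S T : {set G}) (g : G).

Definition marginal w S g : R := w (g |: S) - w S.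

Record one_c_SUB (c : nat) w : Prop := {
  SUB_ge0 : forall S, 0 <= w S;
  SUB_set0 : w set0 = 0;
  SUB_marginal : forall S g, g \notin S ->
    marginal w S g = 1 \/ marginal w S g = c%:R;
  SUB_submodular : forall S T g, S \subset T -> g \notin T ->
    marginal w T g <= marginal w S g
}.

End Valuations.

(* The index [None : option 'I_n] is the dummy agent 0, whose bundle is the
   set of unallocated goods; [Some i] is the agent [i]. *)
Notation bundles n G := {ffun option 'I_n -> {set G}}.

Definition is_allocation n (G : finType) (X : bundles n G) : Prop :=
  (forall i j, i != j -> [disjoint X i & X j]) /\ \bigcup_i X i = [set: G].

Section Leximin.
Context {R : realType} {n : nat} {G : finType}.
Variable v : 'I_n -> {set G} -> R.

Definition sorted_utilities (X : bundles n G) : n.-tuple R :=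
  [tuple of sort <=%R [tuple v i (X (Some i)) | i < n]].

Definition lex_dominates (y z : n.-tuple R) : Prop :=
  exists k : 'I_n,
    (forall j : 'I_n, (j < k)%N -> tnth y j = tnth z j) /\ tnth z k < tnth y k.

Definition leximin (X : bundles n G) : Prop :=
  is_allocation X /\
  forall Y, is_allocation Y ->
    ~ lex_dominates (sorted_utilities Y) (sorted_utilities X).

End Leximin.

Section YankeeSwap.
Context {R : realType} {n : nat} {G : finType}.
Variables (c : nat) (v : 'I_n -> {set G} -> R).
Implicit Types (X Y : bundles n G) (Z : {ffun 'I_n -> {set G}}).
Implicit Types (i h : 'I_n) (g : G).

Definition valuation0 (j : option 'I_n) (S : {set G}) : R :=
  if j is Some i then v i S else c%:R * #|S|%:R.

Definition beta (j : option 'I_n) (S : {set G}) : nat :=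
  \max_(T : {set G} | (T \subset S) && (valuation0 j T == c%:R * #|T|%:R)) #|T|.

Definition exchange X : rel G := fun g g' =>
  [exists j, (g \in X j) && (beta j (g' |: (X j :\ g)) == beta j (X j))].

Definition F X i : {set G} :=
  [set g | beta (Some i) (g |: X (Some i)) == (beta (Some i) (X (Some i))).+1].

(* The path is the nonempty sequence [g :: p]. *)
Definition transfer_path X i g (p : seq G) : Prop :=
  [/\ g \in F X i, path (exchange X) g p & last g p \in X None].

Definition shortest_transfer_path X i g (p : seq G) : Prop :=
  transfer_path X i g p /\
  forall g' p', transfer_path X i g' p' -> (size p <= size p')%N.

(* [zip (g :: p) p] lists the pairs of consecutive vertices of [g :: p]; all
   the moves refer to the bundles before the update. *)
Definition augment X i g (p : seq G) : bundles n G :=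
  [ffun j => (X j :\: [set x in g :: p])
             :|: [set e.2 | e in zip (g :: p) p & e.1 \in X j]
             :|: (if j == Some i then [set g] else set0)].

Definition alloc_union X Z : bundles n G :=
  [ffun j => if j is Some i then X (Some i) :|: Z i
             else ~: \bigcup_i (X (Some i) :|: Z i)].

Definition free_goods X Z : {set G} := X None :\: \bigcup_h Z h.

Definition refill Y Z g Z' : Prop :=
  (exists h g', [/\ g \in Z h, g' \in free_goods Y Z &
     Z' = [ffun k => if k == h then g' |: (Z h :\ g) else Z k]])
  \/ (forall h, g \notin Z h) /\ Z' = Z.

Record state := State {
  clean_part : bundles n G;
  ones_part : {ffun 'I_n -> {set G}};
  active : {set 'I_n}
}.

Definition init : state :=
  State [ffun j => if j is Some _ then set0 else [set: G]] [ffun=> set0] setT.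

Definition output (s : state) : bundles n G :=
  alloc_union (clean_part s) (ones_part s).

Definition running (s : state) : bool :=
  (\sum_h #|ones_part s h| < #|clean_part s None|)%N.

Variable phi : bundles n G -> 'I_n -> R -> R.

Definition gain X (A : {set 'I_n}) (d : R) : \bar R :=
  \big[maxe/-oo%E]_(k in A) (phi X k d)%:E.

Definition first_argmax X (A : {set 'I_n}) (d : R) i : Prop :=
  [/\ i \in A, (phi X i d)%:E = gain X A d &
      forall k, k \in A -> (phi X k d)%:E = gain X A d -> (i <= k)%N].

Definition gain_c (s : state) : \bar R := gain (output s) (active s) c%:R.
Definition gain_1 (s : state) : \bar R := gain (output s) (~: active s) 1.

Variant step (s : state) : state -> Prop :=
| step_swap i g p Z' of running s & (gain_1 s <= gain_c s)%E
    & first_argmax (output s) (active s) c%:R i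
    & shortest_transfer_path (clean_part s) i g p
    & refill (augment (clean_part s) i g p) (ones_part s) (last g p) Z' :
    step s (State (augment (clean_part s) i g p) Z' (active s))
| step_deactivate i of running s & (gain_1 s <= gain_c s)%E
    & first_argmax (output s) (active s) c%:R i
    & (forall g p, ~ transfer_path (clean_part s) i g p) :
    step s (State (clean_part s) (ones_part s) (active s :\ i))
| step_one i g of running s & (gain_c s < gain_1 s)%E
    & first_argmax (output s) (~: active s) 1 i
    & g \in free_goods (clean_part s) (ones_part s) :
    step s (State (clean_part s)
      [ffun k => if k == i then g |: ones_part s i else ones_part s k]
      (active s)).

Inductive reachable : state -> Prop :=
| reachable_init : reachable init
| reachable_step s t of reachable s & step s t : reachable t.

(* The algorithm is nondeterministic (choice of the shortest path and of the
   arbitrary goods): whatever the choices, the run is finite, never gets stuck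
   inside the loop, and ends with an output satisfying [P]. *)
Definition yankee_swap_computes (P : bundles n G -> Prop) : Prop :=
  Acc (fun t s => step s t) init /\
  forall s, reachable s ->
    if running s then exists t, step s t else P (output s).

End YankeeSwap.

Definition leximin_gain {R : realType} {n : nat} {G : finType}
    (c : nat) (v : 'I_n -> {set G} -> R) (X : bundles n G) (i : 'I_n) (d : R) : R :=
  - (c%:R + 1) * v i (X (Some i)) + d.

(* Main.v *)
(* Let [r_i] be the rank function [beta (Some i)] of agent i; then [v_i S] equals
   [#|S| + (c - 1) * r_i S], so an agent holding a clean part of size a and b
   further goods that she values at 1 has utility [c * a + b].  Augmenting along a
   shortest path keeps the allocation clean and enlarges exactly one bundle.
   If S is the set of agents without a transfer path, the goods reachable from
   them show that [\sum_(i in S) r_i (Y_i)] is maximal at the current clean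
   allocation over all allocations Y; hence an agent without a path never gets
   one again, and the clean bundles, filled level by level, maximize
   [\sum_i min (r_i Y_i, L)] for each completed level L.
   Because c is an integer, the gain function serves an agent of least utility,
   with ties broken in favour of the active agents.  So at any time there is a
   level w such that the inactive agents have utility w or w + 1 and the active
   ones [c * L] or [c * (L + 1)], where L is the integer part of w / c.
   An allocation whose sorted utilities u' dominate the output u has, for some s,
   [\sum_i min (u'_i, s) > \sum_i min (u_i, s)] with equality for all smaller
   caps; counting the goods and using the maximality above excludes this. *)
Require Import Defs.
From mathcomp Require Import all_boot all_order all_algebra.
From mathcomp Require Import reals constructive_ereal.
From mathcomp Require Import zify lra ring.

Set Implicit Arguments.
Unset Strict Implicit.
Unset Printing Implicit Defensive.
Import Order.TTheory GRing.Theory Num.Theory.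

(** * Matroid rank functions *)

Section MatroidRank.
Context {G : finType}.
Implicit Types (r : {set G} -> nat) (A B I J Q S T : {set G}) (x y g : G).

(** Matroid rank axioms in unit-increment form, parallel to the conditions on marginals.
    [rank_diminish] is written with sums because subtraction on [nat] truncates. *)
Record is_rank r : Prop := IsRank {
  rank_mono : forall S T, S \subset T -> r S <= r T;
  rank_set0 : r set0 = 0;
  rank_leS : forall S g, r (g |: S) <= (r S).+1;
  rank_diminish : forall S T g, S \subset T -> r (g |: T) + r S <= r (g |: S) + r T
}.

Context {r : {set G} -> nat} (rP : is_rank r).

Lemma rank_diminishU A S T : S \subset T -> r (A :|: T) + r S <= r (A :|: S) + r T.
Proof.
have [k] := ubnP #|A|; elim: k => // k IHk in A *; rewrite ltnS => leAk sST.
have [-> | [x xA]] := set_0Vmem A; first by rewrite !set0U addnC.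
have {}IHk := IHk (A :\ x) _ sST.
have /IHk : #|A :\ x| < k by move: leAk; rewrite (cardsD1 x A) xA.
have := rank_diminish rP x (setUS (A :\ x) sST).
have defU U : A :|: U = x |: (A :\ x :|: U) by rewrite setUA setD1K.
rewrite !defU; lia.
Qed.

Lemma rank_submod A B : r (A :|: B) + r (A :&: B) <= r A + r B.
Proof.
have := rank_diminishU A (subsetIr A B).
by rewrite [A :|: (A :&: B)](setUidPl _) // subsetIl.
Qed.

Lemma rank_le_card S : r S <= #|S|.
Proof.
have [k] := ubnP #|S|; elim: k => // k IHk in S *; rewrite ltnS => leSk.
have [-> | [x xS]] := set_0Vmem S; first by rewrite (rank_set0 rP).
have cS : #|S| = #|S :\ x|.+1 by rewrite (cardsD1 x S) xS.
have := rank_leS rP (S :\ x) x; have := IHk (S :\ x); rewrite setD1K //; lia.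
Qed.

Lemma rank_leD S T : r S <= r (S :\: T) + #|T|.
Proof.
have := rank_submod (S :\: T) T; have := rank_le_card T.
have : r S <= r (S :\: T :|: T).
  by apply: (rank_mono rP); apply/subsetP => x xS; rewrite !inE xS andbT orNb.
lia.
Qed.

(** Here and below [r I = #|I|] expresses independence. Removing [I :\: J] costs at most one unit of
    rank per element. *)
Lemma indepS I J : J \subset I -> r I = #|I| -> r J = #|J|.
Proof.
move=> sJI rI; apply/eqP; rewrite eqn_leq rank_le_card /=.
have := rank_leD I (I :\: J); rewrite rI setDDr setDv set0U (setIidPr sJI).
by rewrite cardsD (setIidPr sJI); have := subset_leq_card sJI; lia.
Qed.

(** An element with no marginal rank over [A] has none over a larger set, so [Q] is absorbed one
    element at a time. *)
Lemma rank_span A Q : (forall q, q \in Q -> r (q |: A) <= r A) -> r (A :|: Q) <= r A.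
Proof.
have [k] := ubnP #|Q|; elim: k => // k IHk in Q *; rewrite ltnS => leQk spQ.
have [-> | [x xQ]] := set_0Vmem Q; first by rewrite setU0.
have {}IHk : r (A :|: Q :\ x) <= r A.
  by apply: IHk => [|q /setD1P[_ /spQ]//]; move: leQk; rewrite (cardsD1 x Q) xQ.
have := rank_diminish rP x (subsetUl A (Q :\ x)); have := spQ x xQ.
rewrite setUCA setD1K //; lia.
Qed.

(* The hypothesis says that the fundamental circuit of [q] in [q |: I] avoids [B]. *)
Lemma rank_circuit I B q : r I = #|I| -> r (q |: I) = #|I| -> B \subset I ->
  (forall x, x \in B -> r (q |: I :\ x) < #|I|) -> r (q |: I :\: B) + #|B| <= #|I|.
Proof.
move=> rI rqI; have [k] := ubnP #|B|; elim: k => // k IHk in B *.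
rewrite ltnS => leBk sBI ltB.
have [-> | [x xB]] := set_0Vmem B; first by rewrite setD0 cards0 addn0 rqI.
have cB : #|B| = #|B :\ x|.+1 by rewrite (cardsD1 x B) xB.
have sB'B : B :\ x \subset B by rewrite subD1set.
have {}IHk : r (q |: I :\: (B :\ x)) + #|B :\ x| <= #|I|.
  apply: IHk => [||y /(subsetP sB'B)/ltB//]; first by rewrite -cB.
  exact: subset_trans sBI.
(* The union of the two sets is [q |: I], of rank [#|I|], and their intersection is [q |: I :\: B];
   submodularity shows that deleting [x] as well costs one more unit. *)
have := rank_submod (q |: I :\: (B :\ x)) (q |: I :\ x); have := ltB x xB.
have -> : (q |: I :\: (B :\ x)) :|: (q |: I :\ x) = q |: I.
  apply/setP => y; rewrite !inE; case: (y == q); case: (eqVneq y x) => [->|] //=.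
    by rewrite (subsetP sBI).
  by case: (y \in B); case: (y \in I).
have -> : (q |: I :\: (B :\ x)) :&: (q |: I :\ x) = q |: I :\: B.
  apply/setP => y; rewrite !inE; case: (y == q); case: (eqVneq y x) => [->|] //=.
    by rewrite xB andbF.
  by case: (y \in B); case: (y \in I).
lia.
Qed.

Definition swap_all I (s : seq (G * G)) : {set G} :=
  (I :\: [set e.1 | e in s]) :|: [set e.2 | e in s].

(* The fundamental circuit of a later [f.2] avoids [e.1], so it survives the
   exchange of [e.1] for [e.2]; hence the pairs can be swapped one after another. *)
Lemma swap_all_indep I (s : seq (G * G)) : r I = #|I| ->
    (forall e : G * G, e \in s -> [/\ e.1 \in I, e.2 \notin I & r (e.2 |: I :\ e.1) = #|I|]) ->
    pairwise (fun e f => r (f.2 |: I :\ e.1) < #|I|) s ->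
  r (swap_all I s) = #|I| /\ #|swap_all I s| = #|I|.
Proof.
elim: s => [|[x y] s IHs] in I * => rI sP /=.
  suff -> : swap_all I [::] = I by [].
  by apply/setP => z; rewrite !inE /= ; apply/orP/idP => [[/andP[]//|/imsetP[]//] | ->]; left; rewrite andbT; apply/imsetP => -[].
case/andP => /allP ltxs pws.
have [/= xI yI rxy] := sP (x, y) (mem_head _ _).
have sPs (e : G * G) : e \in s -> e \in (x, y) :: s by rewrite inE orbC => ->.
pose I' := y |: I :\ x.
have cI' : #|I'| = #|I|.
  by rewrite cardsU1 !inE negb_and yI orbT (cardsD1 x I) xI.
(* Since [e.2] lies in the span of [I :\ x], no later pair shares a good with [(x, y)], and [e.2] is
   spanned by [I]. *)
have sQ (e : G * G) : e \in s -> [/\ e.1 \in I, e.2 \notin I, e.1 != x, e.2 != y & r (e.2 |: I) = #|I|].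
  move=> es; have lte : r (e.2 |: I :\ x) < #|I| := ltxs e es; have [e1I e2I re] := sP e (sPs _ es).
  split=> //; first by apply: contraTneq lte => <-; rewrite re ltnn.
    by apply: contraTneq lte => ->; rewrite rxy ltnn.
  have := rank_diminish rP e.2 (subD1set I x).
  have -> : r (I :\ x) = #|I|.-1.
    by rewrite (@indepS I) ?subD1set // (cardsD1 x I) xI.
  have : 0 < #|I| by rewrite (cardsD1 x I) xI.
  have := rank_mono rP (subsetUr [set e.2] I); rewrite rI; move: lte; clear; lia.
have [] := IHs I'.
- by rewrite cI'.
- move=> e es; have [e1I e2I ne1 ne2 re] := sQ e es.
  have [_ _ ree] := sP e (sPs _ es).
  split; rewrite ?inE ?e1I ?ne1 ?orbT ?negb_or ?ne2 ?negb_and ?e2I ?orbT //= cI'.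
  apply/eqP; rewrite eqn_leq -{1}cI'; apply/andP; split.
    rewrite (leq_trans (rank_le_card _)) // cardsU1 (cardsD1 e.1 I').
    by rewrite /I' !inE ne1 e1I orbT; clear; lia.
  have lte : r (e.2 |: I :\ x) < #|I| by exact: (ltxs e es).
  (* The second set has rank below [#|I|], the union rank at least [#|I|], the intersection rank at
     least [#|I| - 1]; so the first set has rank at least [#|I|]. *)
  have := rank_submod (e.2 |: I' :\ e.1) (e.2 |: I :\ x).
  have -> : (e.2 |: I' :\ e.1) :|: (e.2 |: I :\ x) = e.2 |: I'.
    apply/setP => z; rewrite !inE; case: (z == e.2) => //=.
    case: (eqVneq z e.1) => [->|_]; rewrite ?ne1 ?e1I ?orbT //=.
    by case: (z == y); case: (z \in I); case: (z == x).
  have rI' : #|I| <= r (e.2 |: I').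
    by rewrite -rxy (rank_mono rP) // subsetUr.
  have sub : I :\ x :\ e.1 \subset I :\ e.1 by apply: setSD; apply: subD1set.
  have := rank_diminish rP e.2 sub; rewrite ree.
  have -> : (e.2 |: I' :\ e.1) :&: (e.2 |: I :\ x) = e.2 |: I :\ x :\ e.1.
    apply/setP => z; rewrite !inE; case: (z == e.2) => //=.
    case: (eqVneq z y) => [->|_]; rewrite ?(negPf yI) ?andbF //=.
    by case: (z == e.1); case: (z \in I); case: (z == x).
  have -> : r (I :\ x :\ e.1) = #|I|.-2.
    rewrite (@indepS I) ?(subset_trans sub) ?subD1set // (cardsD1 x I) xI.
    by rewrite (cardsD1 e.1 (I :\ x)) !inE ne1 e1I.
  have -> : r (I :\ e.1) = #|I|.-1.
    by rewrite (@indepS I) ?subD1set // (cardsD1 e.1 I) e1I.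
  have : 1 < #|I| by rewrite (cardsD1 x I) xI (cardsD1 e.1 (I :\ x)) !inE ne1 e1I.
  move: lte rI'; clear; lia.
- have ltI' (e f : G * G) : e \in s -> f \in s ->
      r (f.2 |: I :\ e.1) < #|I| -> r (f.2 |: I' :\ e.1) < #|I'|; last first.
    by move: pws; apply: (@sub_in_pairwise _ [in s]); [move=> e f; apply: ltI' | apply/allP].
  move=> es fs ltef.
  have [e1I e2I ne1 ne2 re] := sQ e es; have [_ f2I _ nf2 rf] := sQ f fs.
  have ltf : r (f.2 |: I :\ x) < #|I| := ltxs f fs.
  (* The fundamental circuit of [f.2] avoids both [x] and [e.1], so [f.2] is spanned by [I :\:
     [set x; e.1]], which lies inside [I' :\ e.1]. *)
  have : r (f.2 |: I :\: [set x; e.1]) + #|[set x; e.1]| <= #|I|.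
    apply: rank_circuit => // [|z]; first by rewrite subUset !sub1set xI.
    by rewrite !inE => /orP[] /eqP ->.
  rewrite cI' cards2 eq_sym ne1 /=.
  have sub : I :\: [set x; e.1] \subset I' :\ e.1.
    apply/subsetP => z; rewrite !inE negb_or => /andP[/andP[-> ->] ->].
    by rewrite orbT.
  have := rank_diminish rP f.2 sub.
  have -> : r (I :\: [set x; e.1]) = #|I|.-2.
    rewrite (@indepS I) ?subsetDl // cardsD (setIidPr _) ?cards2 1?eq_sym ?ne1 ?subn2 //.
    by rewrite subUset !sub1set xI.
  have : r (I' :\ e.1) <= #|I|.-1.
    by rewrite (leq_trans (rank_le_card _)) // -cI' (cardsD1 e.1 I') /I' !inE ne1 e1I orbT.
  have : 1 < #|I| by rewrite (cardsD1 x I) xI (cardsD1 e.1 (I :\ x)) !inE ne1 e1I.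
  clear; lia.
suff -> : swap_all I ((x, y) :: s) = swap_all I' s by rewrite cI'.
apply/setP => z; rewrite !inE.
have -> : (z \in [set e.1 | e in (x, y) :: s]) = (z == x) || (z \in [set e.1 | e in s]).
  apply/imsetP/orP => [[e]|[/eqP ->|/imsetP[e es ->]]].
  - by rewrite inE => /predU1P[-> ->|es ->]; [left | right; apply: imset_f].
  - by exists (x, y); rewrite ?mem_head.
  - by exists e; rewrite // inE es orbT.
have -> : (z \in [set e.2 | e in (x, y) :: s]) = (z == y) || (z \in [set e.2 | e in s]).
  apply/imsetP/orP => [[e]|[/eqP ->|/imsetP[e es ->]]].
  - by rewrite inE => /predU1P[-> ->|es ->]; [left | right; apply: imset_f].
  - by exists (x, y); rewrite ?mem_head.
  - by exists e; rewrite // inE es orbT.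
have [->|nzy] := eqVneq z y; last by case: (z == x); case: (z \in [set e.1 | e in s]).
rewrite !orbT /= andbT; apply/esym/orP; left; apply/imsetP => -[e es yE].
by have [] := sQ e es; rewrite -yE (negPf yI).
Qed.

(* The swapped set has the same span as [I]. *)
Lemma swap_all_indepU I s g : r I = #|I| -> #|I| < r (g |: I) ->
    (forall e : G * G, e \in s -> r (e.2 |: I) <= #|I|) ->
    r (swap_all I s) = #|I| -> #|I| < r (g |: swap_all I s).
Proof.
move=> rI ltg sps rs.
have spU : r (I :|: [set e.2 | e in s]) <= r I.
  by apply: rank_span => _ /imsetP[e es ->]; rewrite rI sps.
have sub : swap_all I s \subset I :|: [set e.2 | e in s] by rewrite setSU // subsetDl.
have := rank_diminish rP g sub.
have : r (g |: I) <= r (g |: (I :|: [set e.2 | e in s])).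
  by rewrite (rank_mono rP) // setUS // subsetUl.
lia.
Qed.

End MatroidRank.

(** * The rank function of a valuation *)

Section Beta.
Context {R : realType} {n : nat} {G : finType} {c : nat}.
Context {v : 'I_n -> {set G} -> R}.
Hypotheses (c_ge2 : 2 <= c) (v_SUB : forall i : 'I_n, one_c_SUB c (v i)).
Implicit Types (S T : {set G}) (g : G) (j : option 'I_n).

(** Treating the dummy agent as one more SUB agent lets all facts on [beta] cover the unallocated
    bundle too. *)
Lemma valuation0_SUB j : one_c_SUB c (valuation0 c v j).
Proof.
case: j => [i|]; first by case: (v_SUB i); split.
split=> /= [S||S g gS|S T g sST gT].
- by rewrite mulr_ge0 ?ler0n.
- by rewrite cards0 mulr0.
- by right; rewrite /marginal /= cardsU1 gS natrD mulrDr mulr1 addrK.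
- rewrite /marginal /= !cardsU1 gT (contra (subsetP sST g)) //.
  by rewrite !natrD !mulrDr !addrK.
Qed.

(** Every marginal is at least 1, so value minus cardinality is monotone. *)
Lemma valuation_sub j S T : T \subset S ->
  (valuation0 c v j T + #|S|%:R <= valuation0 c v j S + #|T|%:R)%R.
Proof.
have [k] := ubnP #|S|; elim: k => // k IHk in S *; rewrite ltnS => leSk sTS.
have [sST | /subsetPn[x xS xT]] := boolP (S \subset T).
  by have -> : S = T by apply/eqP; rewrite eqEsubset sST.
have cS : #|S| = #|S :\ x|.+1 by rewrite (cardsD1 x S) xS.
have := IHk (S :\ x); rewrite -cS subsetD1 sTS xT => /(_ leSk isT).
have := SUB_marginal (valuation0_SUB j) (negbT (setD11 x S)).
rewrite /marginal setD1K // cS => m1.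
have {m1}: (1 <= valuation0 c v j S - valuation0 c v j (S :\ x))%R.
  by case: m1 => ->; rewrite // ler1n (ltnW c_ge2).
rewrite -natr1; lra.
Qed.

(** [T] is collected greedily: a good of marginal [c] joins it, and by submodularity its marginal
    over the smaller set is again [c]; every other good adds 1. *)
Lemma indep_witness j S : exists2 T : {set G}, T \subset S &
  valuation0 c v j T = (c%:R * #|T|%:R)%R /\
  valuation0 c v j S = (#|S| + c.-1 * #|T|)%N%:R%R.
Proof.
have [k] := ubnP #|S|; elim: k => // k IHk in S *; rewrite ltnS => leSk.
have [-> | [x xS]] := set_0Vmem S.
  exists set0; rewrite ?sub0set // (SUB_set0 (valuation0_SUB j)) cards0 muln0 mulr0.
  by split.
have cS : #|S| = #|S :\ x|.+1 by rewrite (cardsD1 x S) xS.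
have [] := IHk (S :\ x); first by rewrite -cS.
move=> T; rewrite subsetD1 => /andP[sTS xT] [vT vS].
have := SUB_marginal (valuation0_SUB j) (negbT (setD11 x S)).
rewrite /marginal setD1K // cS => -[m1|mc].
  exists T => //; split=> //.
  by move: m1 => /eqP; rewrite subr_eq => /eqP ->; rewrite vS addrC natr1.
exists (x |: T); first by rewrite subUset sub1set xS.
rewrite cardsU1 xT; have sT : T \subset S :\ x by rewrite subsetD1 sTS.
have := SUB_marginal (valuation0_SUB j) xT.
have := SUB_submodular (valuation0_SUB j) sT (negbT (setD11 x S)).
rewrite /marginal setD1K // mc vT => le_c m_x; split; last first.
  move: mc => /eqP; rewrite subr_eq => /eqP ->; rewrite vS -natrD; congr (_%:R)%R.
  by move: c_ge2; case: c => [|[|c']] //= _; nia.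
have {m_x} /eqP : (valuation0 c v j (x |: T) - c%:R * #|T|%:R = c%:R)%R.
  by case: m_x le_c => -> //; rewrite lern1 leqNgt c_ge2.
by rewrite subr_eq natrD mulrDr mulr1 => /eqP ->.
Qed.

(** The greedy witness is optimal: by [valuation_sub], any [T'] inside [S] worth [c] per good forces
    [S] to be worth at least [#|S| + c.-1 * #|T'|]. *)
Lemma valuation0E j S : valuation0 c v j S = (#|S| + c.-1 * beta c v j S)%N%:R%R.
Proof.
have [T sTS [vT vS]] := indep_witness j S; rewrite vS; congr (_ + _ * _)%:R%R.
apply/eqP; rewrite eqn_leq; apply/andP; split.
  by rewrite /beta (@leq_bigmax_cond _ _ (fun U : {set G} => #|U|) T) // sTS vT eqxx.
apply/bigmax_leqP => T' /andP[sT'S /eqP vT'].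
have := valuation_sub j sT'S; rewrite vT' vS -natrM -!natrD ler_nat.
by move: c_ge2; case: c => [|[|c']] //= _; nia.
Qed.

(** By [valuation0E], [beta] is value minus cardinality, divided by [c - 1 > 0]; the rank axioms are
    the conditions on marginals after this rescaling. *)
Lemma beta_rank j : is_rank (beta c v j).
Proof.
have rM S g : g \notin S -> (marginal (valuation0 c v j) S g +
    c.-1%:R * (beta c v j S)%:R = 1 + c.-1%:R * (beta c v j (g |: S))%:R)%R.
  move=> gS; rewrite /marginal !valuation0E cardsU1 gS /= !natrD !natrM; ring.
have c1 : (0 < c.-1%:R :> R)%R by rewrite ltr0n; case: c c_ge2 => [|[]].
have mono S T : S \subset T -> beta c v j S <= beta c v j T.
  move=> /(valuation_sub j); rewrite !valuation0E -!natrD ler_nat.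
  have : 0 < c.-1 by case: c c_ge2 => [|[]].
  nia.
have leS S g : beta c v j (g |: S) <= (beta c v j S).+1.
  have [gS | gS] := boolP (g \in S).
    by rewrite (setUidPr _) ?sub1set // leqnSn.
  have := rM S g gS; have := SUB_marginal (valuation0_SUB j) gS.
  move=> m E; have : (c.-1%:R * (beta c v j (g |: S))%:R <= c.-1%:R * (beta c v j S).+1%:R :> R)%R.
    have : (marginal (valuation0 c v j) S g <= c.-1%:R + 1)%R.
      rewrite natr1 prednK ?(ltnW c_ge2) //.
      by case: m => -> //; rewrite ler1n (ltnW c_ge2).
    rewrite -natr1; lra.
  by rewrite ler_pM2l // ler_nat.
split=> // [|S T g sST].
  by apply/eqP; rewrite -leqn0; apply/bigmax_leqP => T; rewrite subset0 => /andP[/eqP -> _]; rewrite cards0.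
have [gS | gS] := boolP (g \in S).
  by rewrite !(setUidPr _) ?sub1set ?(subsetP sST) // addnC.
have [gT | gT] := boolP (g \in T).
  by rewrite (setUidPr _ : g |: T = T) ?sub1set // addnC leq_add2r mono ?subsetUr.
have := SUB_submodular (valuation0_SUB j) sST gT.
have := rM S g gS; have := rM T g gT => ET ES m.
rewrite -(ler_nat R) -(ler_pM2l c1) !natrD !mulrDr; lra.
Qed.

Lemma beta_None S : beta c v None S = #|S|.
Proof.
apply/eqP; rewrite eqn_leq (rank_le_card (beta_rank _)) /=.
by rewrite /beta (@leq_bigmax_cond _ _ (fun U : {set G} => #|U|) S) // subxx eqxx.
Qed.

End Beta.

(** * Shortest augmenting paths *)

Section ZipPath.
Context {T : eqType}.
Implicit Types (x : T) (p : seq T) (e f : T * T).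

Lemma mem_zip_path x p e : e \in zip (x :: p) p ->
  exists p1 p2, p = p1 ++ e.2 :: p2 /\ e.1 = last x p1.
Proof.
elim: p x => //= y p IHp x; rewrite inE => /predU1P[->|/IHp[p1 [p2 [-> ->]]]].
  by exists [::], p.
by exists (y :: p1), p2.
Qed.

Lemma zip_path_mem2 x p y : y \in p -> exists2 e, e \in zip (x :: p) p & e.2 = y.
Proof.
elim: p x => //= z p IHp x; rewrite inE => /predU1P[->|/(IHp z)[e ez <-]].
  by exists (x, z); rewrite ?mem_head.
by exists e; rewrite // inE ez orbT.
Qed.

Lemma zip_path_mem1 x p y : y \in x :: p -> y != last x p ->
  exists2 e, e \in zip (x :: p) p & e.1 = y.
Proof.
elim: p x => [x|z p IHp x]; first by rewrite mem_seq1 => ->.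
rewrite inE => /predU1P[-> _ | /IHp ez /ez[e {}ez <-]].
  by exists (x, z); rewrite //= mem_head.
by exists e; rewrite //= inE ez orbT.
Qed.

Lemma zip_path_inj x p e f : uniq p -> e \in zip (x :: p) p ->
  f \in zip (x :: p) p -> e.2 = f.2 -> e = f.
Proof.
have mem2 (y : T) q (d : T * T) : d \in zip (y :: q) q -> d.2 \in q.
  by case/mem_zip_path=> [p1 [p2 [-> _]]]; rewrite mem_cat mem_head orbT.
elim: p x => //= y p IHp x /andP[yp up]; rewrite !inE.
case/predU1P => [->|ez] /predU1P[->|fz] //=.
- by move=> yE; rewrite yE (mem2 _ _ _ fz) in yp.
- by move=> yE; rewrite -yE (mem2 _ _ _ ez) in yp.
exact: IHp up ez fz.
Qed.

Lemma pairwise_zip_path (e : rel (T * T)) x p :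
  (forall p1 y p2 z p3, p = p1 ++ y :: p2 ++ z :: p3 ->
     e (last x p1, y) (last x (p1 ++ y :: p2), z)) ->
  pairwise e (zip (x :: p) p).
Proof.
elim: p x => //= y p IHp x eP; apply/andP; split.
  apply/allP => -[a b] /mem_zip_path[p1 [p2 /= [defp ->]]].
  by rewrite defp in eP; apply: (eP [::] y p1 b p2).
apply: IHp => p1 z p2 t p3 defp.
by have := eP (y :: p1) z p2 t p3; rewrite /= defp; apply.
Qed.

End ZipPath.

(** * Exchange graph of a clean allocation and augmentation *)

Section Exchange.
Context {R : realType} {n : nat} {G : finType} {c : nat}.
Context {v : 'I_n -> {set G} -> R}.
Hypotheses (c_ge2 : 2 <= c) (v_SUB : forall i : 'I_n, one_c_SUB c (v i)).
Implicit Types (S T : {set G}) (x y g : G) (i k : 'I_n) (j : option 'I_n).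
Implicit Types (X Y : bundles n G) (p : seq G).

Let betaP j := beta_rank c_ge2 v_SUB j.

Lemma allocationP X :
  is_allocation X <-> forall x, exists j0, forall j, (x \in X j) = (j == j0).
Proof.
split=> [[disX covX] x | ownX].
  have : x \in \bigcup_j X j by rewrite covX inE.
  case/bigcupP => j0 _ xj0; exists j0 => j; have [-> //|] := eqVneq j j0.
  by move=> /disX /disjointFl; apply.
split=> [j1 j2 ne|].
  apply/pred0P => x /=; have [j0 xP] := ownX x; rewrite !xP.
  by apply/negbTE; apply: contra ne => /andP[/eqP -> /eqP ->].
apply/setP => x; rewrite inE; have [j0 xP] := ownX x.
by apply/bigcupP; exists j0; rewrite // xP.
Qed.

Definition clean X := is_allocation X /\ forall j, beta c v j (X j) = #|X j|.

Lemma alloc_uniq X x j j' : is_allocation X -> x \in X j -> x \in X j' -> j = j'.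
Proof. by move=> /allocationP /(_ x) [j0 xP]; rewrite !xP => /eqP -> /eqP ->. Qed.

Lemma clean_exchangeE X x y j : clean X -> x \in X j ->
  exchange c v X x y = (beta c v j (y |: X j :\ x) == #|X j|).
Proof.
move=> [allX clX] xj; apply/existsP/idP => [[j' /andP[xj']]|].
  by rewrite (alloc_uniq allX xj xj') clX.
by exists j; rewrite xj clX.
Qed.

Lemma beta_exchange_le X x y j : x \in X j -> beta c v j (y |: X j :\ x) <= #|X j|.
Proof.
move=> xj; rewrite (leq_trans (rank_le_card (betaP j) _)) // cardsU1.
by rewrite [#|X j|](cardsD1 x) xj; lia.
Qed.

Section ShortestPath.
Context {X : bundles n G} {i : 'I_n} {g : G} {p : seq G}.
Hypotheses (clX : clean X) (pP : shortest_transfer_path c v X i g p).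

Let gF : g \in F c v X i. Proof. by case: pP => -[]. Qed.
Let pathp : path (exchange c v X) g p. Proof. by case: pP => -[]. Qed.
Let lastp : last g p \in X None. Proof. by case: pP => -[]. Qed.
Let minp g' p' : transfer_path c v X i g' p' -> size p <= size p'.
Proof. by case: pP => _; apply. Qed.

Lemma shortest_uniq : uniq (g :: p).
Proof.
move: lastp; case: (shortenP pathp) => p' pathp' up' subp' lp'.
have tp' : transfer_path c v X i g p' by split.
apply: (@leq_size_uniq _ (g :: p') (g :: p) up') => [z|]; last by rewrite /= ltnS (minp tp').
by rewrite !inE => /predU1P[->|/subp' ->]; rewrite ?eqxx ?orbT.
Qed.

(** The path could be cut at its first unallocated vertex. *)
Lemma shortest_None x : x \in g :: p -> x \in X None -> x = last g p.
Proof.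
move=> xp xN; case/splitPl defp: {1}p / xp => [p1 p2 lx].
have : size p <= size p1.
  apply: (@minp g); split; rewrite ?lx //.
  by move: pathp; rewrite defp cat_path => /andP[].
case: p2 defp => [|y p2] defp; first by rewrite defp cats0 lx.
by rewrite defp size_cat /=; lia.
Qed.

(** Otherwise the path could start at [y]. *)
Lemma shortest_F y : y \in p -> y \notin F c v X i.
Proof.
move=> yp; apply/negP => yF; case/splitPr defp: {1}p / yp => [p1 p2].
have /minp : transfer_path c v X i y p2.
  split=> //; first by move: pathp; rewrite defp cat_path => /and3P[].
  by move: lastp; rewrite defp last_cat.
by rewrite defp size_cat /=; lia.
Qed.

Lemma shortest_exchange e : e \in zip (g :: p) p -> exchange c v X e.1 e.2.
Proof.
move=> /mem_zip_path[p1 [p2 [defp ->]]].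
by move: pathp; rewrite defp cat_path => /and3P[].
Qed.

(** An edge from the source of one pair to the target of a later one would bypass a vertex. This
    supplies the pairwise hypothesis of [swap_all_indep]. *)
Lemma shortest_no_shortcut :
  pairwise (fun e f => ~~ exchange c v X e.1 f.2) (zip (g :: p) p).
Proof.
apply: pairwise_zip_path => p1 y p2 z p3 defp /=; apply/negP => xz.
have : size p <= size (p1 ++ z :: p3).
  apply: (@minp g); split=> //.
    move: pathp; rewrite defp cat_path [path _ _ (_ :: _)]/= cat_path /=.
    by rewrite cat_path /= xz => /andP[-> /and4P[]].
  by move: lastp; rewrite defp !last_cat /= last_cat.
by rewrite defp !size_cat /= size_cat /=; lia.
Qed.

Let zip_mem e : e \in zip (g :: p) p -> e.1 \in g :: p /\ e.2 \in p.
Proof.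
move=> /mem_zip_path[p1 [p2 [-> ->]]]; split; last by rewrite mem_cat mem_head orbT.
by rewrite -cat_cons mem_cat mem_last.
Qed.

Lemma in_augment j x : (x \in augment X i g p j) =
  [|| (x \notin g :: p) && (x \in X j),
      x \in [set e.2 | e in zip (g :: p) p & e.1 \in X j]
    | (j == Some i) && (x == g)].
Proof.
rewrite ffunE in_setU in_setU in_setD in_set -orbA; congr [|| _, _ | _].
by case: (j == Some i); rewrite inE.
Qed.

(** A good off the path keeps its owner, [g] goes to [i], and any other vertex goes to the owner of
    its predecessor, which is unique because the path has no repetition. *)
Lemma augment_allocation : is_allocation (augment X i g p).
Proof.
have [/allocationP ownX _] := clX; have /= /andP[gp up] := shortest_uniq.
apply/allocationP => x; have [xp|xp] := boolP (x \in g :: p); last first.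
  have [j0 xP] := ownX x; exists j0 => j; rewrite in_augment (negPf xp) -xP /=.
  have [xg xNp] : x != g /\ x \notin p by move: xp; rewrite inE negb_or => /andP.
  rewrite (negPf xg) andbF orbF; have [//|/= _] := boolP (x \in X j).
  apply/negbTE/imsetP => -[e]; rewrite inE => /andP[/zip_mem[_ ep] _] xe.
  by rewrite xe ep in xNp.
move: (xp); rewrite inE => /predU1P[xg|xp'].
  exists (Some i) => j; rewrite in_augment xp xg eqxx andbT /=.
  case: imsetP => // -[e]; rewrite inE => /andP[/zip_mem[_ ep] _] ge.
  by rewrite ge ep in gp.
have [e ez ex] := zip_path_mem2 g xp'; have [j0 e1P] := ownX e.1.
exists j0 => j; rewrite in_augment xp -e1P /=.
have -> : (x == g) = false by apply/negbTE; apply: contraNneq gp => <-.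
rewrite andbF orbF; apply/imsetP/idP => [[f]|ej].
  rewrite inE => /andP[fz fj] xf; rewrite (zip_path_inj up ez fz) //.
  by rewrite ex xf.
by exists e; rewrite // inE ez.
Qed.

Lemma augment_None : augment X i g p None = X None :\ last g p.
Proof.
have [allX _] := clX; have /= /andP[gp up] := shortest_uniq.
have uL e : e \in zip (g :: p) p -> e.1 \notin X None.
  move=> ez; have [e1 _] := zip_mem ez; apply/negP => /(shortest_None e1) e1l.
  case: (mem_zip_path ez) => p1 [p2 [defp e1E]].
  have := shortest_uniq; rewrite defp -cat_cons cat_uniq => /and3P[_ /hasPn H _].
  have /H /negP[] : last g p \in e.2 :: p2 by rewrite defp last_cat /= mem_last.
  by rewrite /= -e1l e1E mem_last.
rewrite ffunE setU0; have -> : [set e.2 | e in zip (g :: p) p & e.1 \in X None] = set0.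
  apply/setP => x; rewrite inE; apply/negbTE/imsetP => -[e].
  by rewrite inE => /andP[/uL/negPf ->].
rewrite setU0; apply/setP => x; rewrite in_setD in_setD1 in_set.
have [xN|] := boolP (x \in X None); last by rewrite !andbF.
rewrite !andbT; congr (~~ _); apply/idP/eqP => [/shortest_None -> //|->].
exact: mem_last.
Qed.

(** Each path good that agent [k] loses is the source of an edge whose target she receives; the only
    vertex without outgoing edge is the last one, which is unallocated. *)
Lemma augment_swap k :
  let s := [seq e <- zip (g :: p) p | e.1 \in X (Some k)] in
  [/\ augment X i g p (Some k) =
        swap_all (X (Some k)) s :|: (if k == i then [set g] else set0),
      beta c v (Some k) (swap_all (X (Some k)) s) = #|X (Some k)|
    & #|swap_all (X (Some k)) s| = #|X (Some k)|].
Proof.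
have [allX clX'] := clX; move=> s; pose I := X (Some k).
have sP e : (e \in s) = (e \in zip (g :: p) p) && (e.1 \in I).
  by rewrite mem_filter andbC.
have [] : beta c v (Some k) (swap_all I s) = #|I| /\ #|swap_all I s| = #|I|.
  apply: (swap_all_indep (betaP _)) => // [e|].
    rewrite sP => /andP[ez e1]; have := shortest_exchange ez.
    rewrite (clean_exchangeE _ clX e1) => /eqP rE; split=> //.
    apply: contra_eqN rE => e2.
    have ne : e.1 != e.2.
      have [p1 [p2 [defp ->]]] := mem_zip_path ez.
      have := shortest_uniq; rewrite defp -cat_cons cat_uniq => /and3P[_ /hasPn H _].
      by apply: contraTneq (mem_last g p1) => ->; apply: (H e.2); rewrite mem_head.
    rewrite neq_ltn (leq_ltn_trans (rank_le_card (betaP _) _)) //.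
    rewrite (setUidPr _); last by rewrite sub1set !inE eq_sym ne.
    by rewrite -/I [#|I|](cardsD1 e.1) e1.
  have := pairwise_filter (fun e => e.1 \in I) shortest_no_shortcut.
  apply: (@sub_in_pairwise _ [in s]) => [e f es _|]; last exact/allP.
  move: (es : e \in s); rewrite sP => /andP[_ e1]; rewrite (clean_exchangeE _ clX e1).
  by rewrite ltn_neqAle => -> /=; apply: beta_exchange_le.
split=> //; rewrite ffunE; congr (_ :|: _ :|: _).
  apply/setP => x; rewrite !inE; have [xk|_] := boolP (x \in X (Some k)); last by rewrite !andbF.
  rewrite !andbT; congr (~~ _); apply/idP/imsetP => [xp|[e]]; last first.
    by rewrite sP => /andP[/zip_mem[+ _] _] -> ; rewrite inE.
  have [||e ez ex] := @zip_path_mem1 _ g p x; first by rewrite inE.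
    by apply: contraTneq xk => ->; apply/negP => /(alloc_uniq allX lastp).
  by exists e; rewrite // sP ez ex.
by apply/setP => y; apply/imsetP/imsetP => -[e e1 ->]; exists e => //; move: e1; rewrite inE sP.
Qed.

(** For [k = i], the good [g] is outside the span of the old bundle because it is in [F], while
    [shortest_F] keeps all swapped-in goods inside that span; so [g] stays independent after the
    swaps. *)
Lemma augment_clean_card k :
  #|augment X i g p (Some k)| = #|X (Some k)| + (k == i) /\
  beta c v (Some k) (augment X i g p (Some k)) = #|augment X i g p (Some k)|.
Proof.
have [-> rs cs] := augment_swap k; case: eqP => [ki|_]; last first.
  by rewrite setU0 addn0 cs rs.
subst k; rewrite setUC; set J := swap_all _ _ in rs cs *.
have [_ /(_ (Some i)) rI] := clX.
have gI : #|X (Some i)| < beta c v (Some i) (g |: X (Some i)).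
  by move: gF; rewrite inE rI => /eqP ->.
have gJ : #|X (Some i)| < beta c v (Some i) (g |: J).
  apply: (swap_all_indepU (betaP _)) => // e; rewrite mem_filter => /andP[_ /zip_mem[_]].
  move=> /shortest_F; rewrite inE -rI => neS; rewrite -ltnS ltn_neqAle neS.
  exact: (rank_leS (betaP _)).
have gNJ : g \notin J.
  by apply: contraTN gJ => gJ; rewrite (setUidPr _) ?sub1set // rs ltnn.
rewrite cardsU1 gNJ cs addnC; split=> //; apply/eqP; rewrite addn1 eqn_leq gJ andbT.
by rewrite -rs (rank_leS (betaP _)).
Qed.

Lemma augment_clean : clean (augment X i g p).
Proof.
split=> [|[k|]]; first exact: augment_allocation.
  by have [] := augment_clean_card k.
by rewrite (beta_None c_ge2 v_SUB).
Qed.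

Lemma augment_card k : #|augment X i g p (Some k)| = #|X (Some k)| + (k == i).
Proof. by have [] := augment_clean_card k. Qed.

End ShortestPath.

End Exchange.
Arguments clean {R n G} c v X.

(** * Agents without a transfer path *)

Section Tight.
Context {R : realType} {n : nat} {G : finType} {c : nat}.
Context {v : 'I_n -> {set G} -> R}.
Hypotheses (c_ge2 : 2 <= c) (v_SUB : forall i : 'I_n, one_c_SUB c (v i)).
Implicit Types (S T A : {set G}) (x y g : G) (i k : 'I_n) (j : option 'I_n).
Implicit Types (X Y : bundles n G) (p : seq G).

Let betaP j := beta_rank c_ge2 v_SUB j.

(** Stated with [connect] so as to be a boolean predicate that can index sums. *)
Definition no_path X i : bool :=
  [forall x in F c v X i, forall y in X None, ~~ connect (exchange c v X) x y].

Lemma no_pathP X i : reflect (forall g p, ~ transfer_path c v X i g p) (no_path X i).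
Proof.
apply: (iffP forall_inP) => [noP g p [gF pathp lastp]|noP x xF].
  have /forall_inP/(_ _ lastp)/negP[] := noP g gF.
  by apply/connectP; exists p.
apply/forall_inP => y yN; apply/negP => /connectP[p pathp defy].
by apply: (noP x p); split; rewrite -?defy.
Qed.

Lemma exists_shortest X i : ~~ no_path X i ->
  exists g p, shortest_transfer_path c v X i g p.
Proof.
pose tpb g p := [&& g \in F c v X i, path (exchange c v X) g p & last g p \in X None].
have tpP g p : reflect (transfer_path c v X i g p) (tpb g p) by apply: and3P.
pose hasP (m : nat) := [exists g, [exists q : m.-tuple G, tpb g q]].
have hasI g p : transfer_path c v X i g p -> hasP (size p).
  by move=> tp; apply/existsP; exists g; apply/existsP; exists (in_tuple p); apply/tpP.
case/forall_inPn => x xF /forall_inPn[y yN /negPn/connectP[p pathp defy]].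
have exk : exists m, hasP m by exists (size p); apply: (hasI x); split; rewrite -?defy.
case: (ex_minnP exk) => k /existsP[g /existsP[q /tpP tq]] mink.
by exists g, q; split=> // g' p' /hasI/mink; rewrite size_tuple.
Qed.

Lemma sum_card_allocI Y (P : pred 'I_n) A : is_allocation Y ->
  \sum_(i | P i) #|Y (Some i) :&: A| =
  #|[set x in A | [exists i, P i && (x \in Y (Some i))]]|.
Proof.
move=> /allocationP ownY; rewrite -sum1_card.
transitivity (\sum_(i | P i) \sum_x ((x \in Y (Some i)) && (x \in A) : nat)).
  apply: eq_bigr => i _; rewrite -sum1_card big_mkcond.
  by apply: eq_bigr => x _; rewrite inE; case: andP.
rewrite exchange_big [RHS]big_mkcond; apply: eq_bigr => x _; rewrite inE.
have [[k|] xP] := ownY x; last first.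
  rewrite big1 => [|i _]; last by rewrite xP.
  by case: existsP => [[i]|]; rewrite ?andbF // xP andbF.
have -> : [exists i, P i && (x \in Y (Some i))] = P k.
  apply/existsP/idP => [[i]|Pk]; last by exists k; rewrite Pk xP eqxx.
  by rewrite xP => /andP[Pi /eqP[<-]].
have [Pk|Pk] := boolP (P k); last first.
  rewrite andbF big1 // => i Pi; rewrite xP.
  by case: eqP => // -[ik]; rewrite -ik Pi in Pk.
rewrite (bigD1 k) //= xP eqxx big1 => [|i /andP[_ ne]]; last first.
  by rewrite xP; case: eqP => // -[ik]; rewrite ik eqxx in ne.
by rewrite addn0 andbT; case: (x \in A).
Qed.

Lemma sum_card_alloc Y : is_allocation Y ->
  \sum_i #|Y (Some i)| + #|Y None| = #|G|.
Proof.
move=> alY; have := sum_card_allocI xpredT setT alY.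
under eq_bigr do rewrite setIT.
move=> ->; rewrite addnC -[RHS](cardsC (Y None)); congr (_ + _).
apply: eq_card => x; rewrite !inE /=; move/allocationP: alY => ownY.
have [[k|] xP] := ownY x; rewrite xP.
  by apply/existsP; exists k; rewrite xP eqxx.
by apply/negbTE/existsP => -[k]; rewrite xP.
Qed.

(** Min-max argument on the set [Rch] of goods reachable from the agents without a path. These
    agents own all of [Rch] in [X], and outside [Rch] each of them already has a spanning set. *)
Lemma tight X Y : clean c v X -> is_allocation Y ->
  \sum_(i | no_path X i) beta c v (Some i) (Y (Some i)) <=
  \sum_(i | no_path X i) #|X (Some i)|.
Proof.
move=> clX alY; have [alX rX] := clX.
pose Rch := [set y | [exists x, [exists i, no_path X i && (x \in F c v X i)]
                              && connect (exchange c v X) x y]].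
have RchN y : y \in Rch -> y \notin X None.
  rewrite inE => /existsP[x /andP[/existsP[i /andP[npi xF]] xy]].
  apply: contraTN xy => yN; exact: (forall_inP (forall_inP npi x xF)).
have RchS y z : y \in Rch -> connect (exchange c v X) y z -> z \in Rch.
  rewrite !inE => /existsP[x /andP[Fx xy]] yz; apply/existsP; exists x.
  by rewrite Fx (connect_trans xy yz).
have RchF i : no_path X i -> F c v X i \subset Rch.
  move=> npi; apply/subsetP => x xF; rewrite inE; apply/existsP; exists x.
  by rewrite connect0 andbT; apply/existsP; exists i; rewrite npi.
(* Any [x] in [F] of agent [k] can replace her good [y], so [y] has an edge to [x]; a path from [x]
   to an unallocated good would then start in [Rch]. *)
have Rchk y k : y \in Rch -> y \in X (Some k) -> no_path X k.
  move=> yR yk; apply/forall_inP => x xF; apply/forall_inP => z zN.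
  apply/negP => xz; suff xR : x \in Rch by move: (RchN _ (RchS _ _ xR xz)); rewrite zN.
  apply: (RchS _ _ yR); apply: connect1; rewrite (clean_exchangeE _ clX yk).
  move: xF; rewrite inE rX => /eqP xF.
  have xNk : x \notin X (Some k).
    apply: contra_eqN xF => xk.
    have -> : x |: X (Some k) = X (Some k) by apply/setUidPr; rewrite sub1set.
    by rewrite rX neq_ltn leqnn.
  have cU : #|x |: X (Some k)| = #|X (Some k)|.+1 by rewrite cardsU1 xNk.
  rewrite (indepS (betaP _) (setUS _ (subD1set _ _))) ?cU //.
  by rewrite cardsU1 !inE (negPf xNk) andbF /= [X in _ == X](cardsD1 y) yk.
pose Q := ~: Rch.
have rQ i : no_path X i -> beta c v (Some i) Q <= #|X (Some i) :&: Q|.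
  move=> npi; have rI := rX (Some i); set I := X (Some i) in rI *.
  have rA : beta c v (Some i) (I :&: Q) = #|I :&: Q|.
    by apply: (indepS (betaP _) _ rI); apply: subsetIl.
  suff span : beta c v (Some i) (I :&: Q :|: Q) <= beta c v (Some i) (I :&: Q).
    by rewrite -rA (leq_trans _ span) // (rank_mono (betaP _)) // subsetUr.
  apply: (rank_span (betaP _)) => q qQ.
  have [qI | qI] := boolP (q \in I).
    by rewrite (setUidPr _) // sub1set inE qI.
  have qF : q \notin F c v X i.
    by apply/negP => /(subsetP (RchF i npi)); move: qQ; rewrite inE => /negPf ->.
  have rqI : beta c v (Some i) (q |: I) = #|I|.
    move: qF; rewrite inE -/I rI => ne; apply/eqP; rewrite eqn_leq.
    rewrite -ltnS ltn_neqAle ne -rI (rank_leS (betaP _)) /=.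
    by rewrite (rank_mono (betaP _)) // subsetUr.
  (* No edge leaves [Rch], so the fundamental circuit of [q] avoids [I :&: Rch] and [q] is spanned
     by [I :&: Q]. *)
  have := rank_circuit (betaP _) rI rqI (subsetIl I Rch).
  have -> : I :\: (I :&: Rch) = I :&: Q by rewrite setDIr setDv set0U setDE.
  rewrite rA => circ; have := cardsID Rch I; rewrite setDE -/Q => cI.
  suff /circ : forall x, x \in I :&: Rch -> beta c v (Some i) (q |: I :\ x) < #|I| by lia.
  move=> x /setIP[xI xR]; rewrite ltn_neqAle (beta_exchange_le c_ge2 v_SUB _ xI) andbT.
  rewrite -(clean_exchangeE _ clX xI); apply/negP => xq.
  by move: qQ; rewrite inE (RchS _ _ xR (connect1 xq)).
have leY i : no_path X i ->
    beta c v (Some i) (Y (Some i)) <= #|X (Some i) :&: Q| + #|Y (Some i) :&: Rch|.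
  move=> npi; have := rank_leD (betaP (Some i)) (Y (Some i)) (Y (Some i) :&: Rch).
  have : beta c v (Some i) (Y (Some i) :\: (Y (Some i) :&: Rch)) <= beta c v (Some i) Q.
    by rewrite (rank_mono (betaP _)) // setDIr setDv set0U setDE subsetIr.
  by have := rQ i npi; lia.
apply: leq_trans (leq_sum _ leY) _; rewrite big_split /=.
rewrite [X in _ <= X](eq_bigr (fun i => #|X (Some i) :&: Q| + #|X (Some i) :&: Rch|)); last first.
  by move=> i _; rewrite addnC -[LHS](cardsID Rch) setDE.
(* The bundles of [Y] meet [Rch] in disjoint sets, while [X] gives all of [Rch] to agents without a
   path. *)
rewrite big_split leq_add2l /= !sum_card_allocI //; apply: subset_leq_card.
apply/subsetP => x; rewrite !inE => /andP[xR _]; rewrite xR /=.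
have /allocationP /(_ x) [[k|] xP] := alX; last first.
  by have := RchN x; rewrite inE xP => /(_ xR).
have xk : x \in X (Some k) by rewrite xP eqxx.
by apply/existsP; exists k; rewrite xk andbT (Rchk x) // inE.
Qed.

(** If [i] gained a path, a second augmentation would give the agents that had no path in [X] a
    clean total above the bound of [tight]. *)
Lemma no_path_augment X k g p i : clean c v X -> shortest_transfer_path c v X k g p ->
  no_path X i -> no_path (augment X k g p) i.
Proof.
move=> clX sp npi; apply: contraT => /exists_shortest[g' [p' sp']].
have clX' := augment_clean c_ge2 v_SUB clX sp.
have [alX2 rX2] := augment_clean c_ge2 v_SUB clX' sp'.
have := tight clX alX2; rewrite leqNgt => /negP[].
rewrite (bigD1 i) //= [X in _ < X](bigD1 i) //= rX2.
rewrite (augment_card c_ge2 v_SUB clX' sp') (augment_card c_ge2 v_SUB clX sp) eqxx.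
rewrite addn1 -addSn leq_add ?ltnS ?leq_addr //; apply: leq_sum => h _.
rewrite rX2 (augment_card c_ge2 v_SUB clX' sp') (augment_card c_ge2 v_SUB clX sp).
by rewrite -addnA leq_addr.
Qed.

End Tight.
Arguments no_path {R n G} c v X i.

(** * Capped sums and lexicographic order *)

Section Capped.
Context {n : nat}.
Implicit Types (u a b f g : 'I_n -> nat) (s K L w : nat).

(** Sums of truncated utilities are insensitive to the order of the agents; comparing them at
    successive caps replaces comparing sorted vectors. *)
Definition capped_sum u s := \sum_i minn (u i) s.

Lemma leq_sum_eq f g : (forall i, f i <= g i) -> \sum_i g i <= \sum_i f i ->
  forall i, f i = g i.
Proof.
move=> le_fg le_gf i; apply/eqP; rewrite eqn_leq le_fg /=.
move: le_gf; rewrite (bigD1 i) //= [X in _ <= X](bigD1 i) //=.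
have : \sum_(k | k != i) f k <= \sum_(k | k != i) g k by apply: leq_sum => k _.
move=> le_fg' le_gf; rewrite -(leq_add2r (\sum_(k | k != i) f k)).
by rewrite (leq_trans _ le_gf) // leq_add2l.
Qed.

(* Bounds the utility [c * x + y] cut off at [c * L + r]: of the [x] goods of
   value [c], the first [L] lie below the cut and the next one contributes [r];
   any other good is counted with 1. *)
Definition credit c L r x y := x + y + (c - r) * minn x L + (r - 1) * minn x L.+1.

(** For [x <= L] the credit is [c * x + y]. For [x > L] it is [x + y + (c - 1) * L + (r - 1)], which
    is at least [c * L + r] as [x + y >= L + 1]. *)
Lemma min_le_credit c L r x y : 0 < r <= c ->
  minn (c * x + y) (c * L + r) <= credit c L r x y.
Proof.
move=> /andP[r_gt0 le_rc]; rewrite /credit; have [xL|Lx] := leqP x L.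
  by rewrite (minn_idPl (leqW xL)); rewrite geq_min; apply/orP; left; nia.
rewrite (minn_idPr Lx) geq_min; apply/orP; right.
have := leq_mul (leqnn (c - r)) (leqnn L); nia.
Qed.

(** For [x > L], equality forces [x + y = L + 1], hence [y = 0]; for [x <= L] it keeps the utility
    below the cut. *)
Lemma credit_tight c L r x y : 0 < r <= c ->
  minn (c * x + y) (c * L + r) = credit c L r x y -> c * x + y <= c * L.+1.
Proof.
move=> /andP[r_gt0 le_rc]; rewrite /credit; have [xL|Lx] := leqP x L.
  rewrite (minn_idPl (leqW xL)) => E.
  have : c * x + y <= c * L + r by rewrite -[_ + y]/(_); nia.
  by rewrite mulnS; lia.
rewrite (minn_idPr Lx) => E.
have : x + y <= L.+1 by nia.
move=> le1; have -> : x = L.+1 by lia.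
have -> : y = 0 by lia.
by rewrite addn0.
Qed.

(** The two alternatives are the situations of active and of inactive agents. *)
Lemma credit_eq c L r x y : 0 < r <= c ->
    (y = 0 /\ x <= L.+1) \/ (x <= L /\ c * x + y <= c * L + r) ->
  credit c L r x y = minn (c * x + y) (c * L + r).
Proof.
move=> rc H; apply/eqP; rewrite eqn_leq min_le_credit // andbT.
move: rc => /andP[r_gt0 le_rc]; rewrite /credit leq_min.
have [xL|Lx] := leqP x L.
  by rewrite (minn_idPl (leqW xL)); case: H => -[H1 H2]; apply/andP; split; nia.
case: H => -[H1 H2]; last lia.
have -> : x = L.+1 by lia.
rewrite minnn H1; apply/andP; split; nia.
Qed.

(** * Comparison of the final utilities with a competing allocation *)

Section Final.
Variables (c w m : nat) (a b a' b' : 'I_n -> nat) (U : {set 'I_n}).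
Let L := w %/ c.
Let u i := c * a i + b i.
Let u' i := c * a' i + b' i.
Hypotheses (c_gt0 : 0 < c) (w_le : forall i, w <= u i).
Hypothesis inU : forall i, i \in U -> b i = 0 /\ a i <= L.+1.
Hypothesis notinU : forall i, i \notin U -> a i <= L /\ u i <= w.+1.
Hypothesis eqU : forall i k, i \in U -> u i = w -> k \notin U -> u k = w.
Hypothesis maxL : capped_sum a' L <= capped_sum a L.
Hypothesis maxLS : (forall i, i \in U -> u i <> w) -> capped_sum a' L.+1 <= capped_sum a L.+1.
Hypotheses (sum_m : \sum_i (a i + b i) = m) (sum'_m : \sum_i (a' i + b' i) <= m).

Let wL : w = c * L + w %% c. Proof. by rewrite mulnC -divn_eq. Qed.
Let modw : w %% c < c. Proof. by rewrite ltn_mod. Qed.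

Lemma credit_sum r (x y : 'I_n -> nat) : \sum_i credit c L r (x i) (y i) =
  \sum_i (x i + y i) + (c - r) * capped_sum x L + (r - 1) * capped_sum x L.+1.
Proof. by rewrite /credit /capped_sum !big_split /= !big_distrr. Qed.

(** Summed credits depend only on the number of goods and on the clean sums capped at [L] and
    [L.+1]; the latter has weight [r - 1], so it drops out for [r = 1]. *)
Lemma capped_max r : 0 < r <= c -> w < c * L + r ->
    r = 1 \/ (forall i, i \in U -> u i <> w) ->
  \sum_i credit c L r (a' i) (b' i) <= capped_sum u (c * L + r).
Proof.
move=> rc w_lt Hr; have -> : capped_sum u (c * L + r) = \sum_i credit c L r (a i) (b i).
  apply: eq_bigr => i _; rewrite credit_eq //.
  have [/inU[-> ?]|/notinU[aL ui]] := boolP (i \in U); [by left | right].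
  by split=> //; apply: leq_trans ui _.
rewrite !credit_sum sum_m; case: Hr => [->|/maxLS maxLS'].
  by rewrite !mul0n !addn0 leq_add // leq_mul.
by rewrite !leq_add // leq_mul.
Qed.

(** Equality of the sums forces equality in [min_le_credit] for every agent, and then [credit_tight]
    bounds each utility. *)
Lemma capped_le s : w < s <= c * L.+1 ->
    s = (c * L).+1 \/ (forall i, i \in U -> u i <> w) ->
  capped_sum u' s <= capped_sum u s /\
  (capped_sum u' s = capped_sum u s -> forall i, u' i <= c * L.+1).
Proof.
move=> /andP[w_lt s_le] Hs; pose r := s - c * L.
have sE : s = c * L + r by rewrite /r; lia.
have rc : 0 < r <= c by rewrite mulnS in s_le; lia.
have := @capped_max r rc; rewrite -sE => /(_ w_lt).
have Hr : r = 1 \/ (forall i, i \in U -> u i <> w) by case: Hs; [left; lia | right].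
move=> /(_ Hr) max_r.
have le_r i : minn (u' i) s <= credit c L r (a' i) (b' i) by rewrite sE min_le_credit.
split=> [|eq_s i]; first exact: leq_trans (leq_sum _ (fun i _ => le_r i)) max_r.
have := leq_sum_eq le_r (leq_trans max_r (eq_leq (esym eq_s))) i.
by rewrite sE; apply: credit_tight.
Qed.

Lemma capped_not_dominated th : (forall s, s <= th -> capped_sum u' s = capped_sum u s) ->
  capped_sum u' th.+1 <= capped_sum u th.+1.
Proof.
(* Up to the cap [w] every agent of the output attains the cap. *)
move=> eq_th; have [th_w|w_th] := ltnP th w.
  apply: leq_sum => i _; rewrite [X in _ <= X](minn_idPr _) ?geq_minr //.
  exact: leq_trans th_w (w_le i).
have w_lt : w < c * L.+1 by rewrite mulnS; have := wL; have := modw; lia.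
have [/existsP[i0 /andP[i0U /eqP ui0]] | noU] := boolP [exists i in U, u i == w]; last first.
  have noU' i : i \in U -> u i <> w.
    by move=> iU ui; move/negP: noU; apply; apply/existsP; exists i; rewrite iU ui eqxx.
  have [th_le|th_gt] := ltnP th (c * L.+1).
    by have [] := @capped_le th.+1 _ (or_intror noU'); rewrite // ltnS w_th.
  (* Equality at the cap [c * L.+1] bounds all [u'] by it, so larger caps change nothing on that
     side. *)
  have [|_ /(_ (eq_th _ th_gt)) u'_le] := @capped_le (c * L.+1) _ (or_intror noU').
    by rewrite w_lt leqnn.
  have -> : capped_sum u' th.+1 = capped_sum u' (c * L.+1).
    by apply: eq_bigr => i _; have := u'_le i; lia.
  by rewrite eq_th // leq_sum // => i _; lia.
have [bi0 ai0] := inU i0U.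
have wE : w = c * L.
  move: ui0; rewrite /u bi0 addn0 => ui0; have : c * a i0 < c * L.+1 by rewrite ui0.
  rewrite ltn_pmul2l // ltnS => aL; apply/eqP; rewrite eqn_leq -{1}ui0 leq_mul //=.
  by rewrite mulnC leq_divM.
have uE i : u i = w \/ u i = c * L.+1.
  have [/inU[bi ai]|iU] := boolP (i \in U); last by left; apply: eqU i0U ui0 iU.
  have := w_le i; rewrite wE /u bi addn0 leq_pmul2l //.
  by move: ai; rewrite leq_eqVlt ltnS => /predU1P[-> _|aL La]; [right | left; congr (_ * _); lia].
have w1 : w < w.+1 <= c * L.+1 by rewrite ltnSn.
have [le_w1 tight_w1] := capped_le w1 (or_introl (congr1 S wE)).
move: w_th; rewrite leq_eqVlt => /predU1P[<- //|w_th].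
have eq_w := eq_th w (ltnW w_th); have eq_w1 := eq_th w.+1 w_th.
have u'_le := tight_w1 eq_w1.
(* [K] is what an agent at [c * L.+1] gains when the cap moves from [w] to [th.+1]. The difference
   of the caps [w.+1] and [w] counts the agents above [w]; each gains at most [K], and exactly [K]
   in the output. *)
pose K := minn th.+1 (c * L.+1) - w.
have bound x : x <= c * L.+1 -> minn x th.+1 + minn x w * K <= minn x w + minn x w.+1 * K.
  move=> xle; have [xw|wx] := leqP x w; first by rewrite !(minn_idPl _); lia.
  by rewrite (minn_idPr wx) mulSn /K; lia.
have bound_eq x : x = w \/ x = c * L.+1 ->
    minn x th.+1 + minn x w * K = minn x w + minn x w.+1 * K.
  case=> ->; first by rewrite !(minn_idPl _); lia.
  by rewrite (minn_idPr (ltnW w_lt)) (minn_idPr w_lt) mulSn /K; lia.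
have : capped_sum u' th.+1 + capped_sum u' w * K <= capped_sum u' w + capped_sum u' w.+1 * K.
  by rewrite /capped_sum !big_distrl -!big_split leq_sum // => i _; apply: bound.
have : capped_sum u th.+1 + capped_sum u w * K = capped_sum u w + capped_sum u w.+1 * K.
  by rewrite /capped_sum !big_distrl -!big_split; apply: eq_bigr => i _; apply: bound_eq.
by rewrite eq_w eq_w1 => <-; rewrite leq_add2r.
Qed.

End Final.

End Capped.

(** * Lexicographic domination expressed by capped sums *)

Section Lexicographic.
Context {R : realType} {n : nat} {G : finType}.
Context {v : 'I_n -> {set G} -> R}.
Implicit Types (X Y : bundles n G) (u : 'I_n -> nat).
Local Open Scope ring_scope.

Lemma capped_sumE X u s : (forall i, v i (X (Some i)) = (u i)%:R) ->
  (capped_sum u s)%:R = \sum_j Num.min (tnth (sorted_utilities v X) j) s%:R.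
Proof.
move=> vE; rewrite -(big_tuple _ _ _ xpredT (fun x => Num.min x s%:R)) /=.
rewrite (perm_big _ (permEl (perm_sort _ _))) /= big_map big_enum natr_sum /=.
by apply: eq_bigr => i _; rewrite vE -natr_min minEnat.
Qed.

Lemma sorted_utility_nat X u : (forall i, v i (X (Some i)) = (u i)%:R) ->
  forall j, exists k : nat, tnth (sorted_utilities v X) j = k%:R.
Proof.
move=> vE j; have := mem_tnth j (sorted_utilities v X).
by rewrite mem_sort => /mapP[i _ ->]; exists (u i); rewrite vE.
Qed.

Lemma sorted_utility_le X (j k : 'I_n) : (j <= k)%N ->
  tnth (sorted_utilities v X) j <= tnth (sorted_utilities v X) k.
Proof.
move=> jk; rewrite !(tnth_nth 0) /=; apply: (le_sorted_leq_nth 0 (sort_le_sorted _)) => //.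
  by rewrite inE size_sort size_map size_enum_ord.
by rewrite inE size_sort size_map size_enum_ord.
Qed.

(** [th] is the dominated entry at the first difference. From there on both sorted vectors are at
    least [th], and by integrality the dominating one is at least [th.+1]. *)
Lemma lex_dominates_capped X Y u u' : (forall i, v i (X (Some i)) = (u i)%:R) ->
    (forall i, v i (Y (Some i)) = (u' i)%:R) ->
    lex_dominates (sorted_utilities v Y) (sorted_utilities v X) ->
  exists th, (forall s, (s <= th)%N -> capped_sum u' s = capped_sum u s) /\
    (capped_sum u th.+1 < capped_sum u' th.+1)%N.
Proof.
move=> uE u'E [k [eq_k lt_k]]; set y := sorted_utilities v Y in eq_k lt_k.
set z := sorted_utilities v X in eq_k lt_k.
have [th zk] := sorted_utility_nat uE k; rewrite -/z in zk.
have zk_le (j : 'I_n) : (k <= j)%N -> th%:R <= tnth z j.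
  by rewrite -zk; apply: sorted_utility_le.
have yk_le (j : 'I_n) : (k <= j)%N -> th.+1%:R <= tnth y j.
  move=> kj; have := lt_le_trans lt_k (sorted_utility_le Y kj); rewrite -/y zk.
  by have [m ->] := sorted_utility_nat u'E j; rewrite ltr_nat ler_nat.
exists th; split=> [s s_th|].
  apply/eqP; rewrite -(eqr_nat R) (capped_sumE s uE) (capped_sumE s u'E).
  apply/eqP/eq_bigr => j _; have [jk|kj] := ltnP j k; first by rewrite -/y eq_k.
  rewrite !min_r //; first by rewrite (le_trans _ (zk_le j kj)) // ler_nat.
  by rewrite (le_trans _ (yk_le j kj)) // ler_nat (leq_trans s_th).
rewrite -(ltr_nat R) (capped_sumE _ uE) (capped_sumE _ u'E) -/y -/z.
rewrite (bigD1 k) //= [ltRHS](bigD1 k) //=; apply: ltr_leD.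
  by rewrite min_l ?zk ?ler_nat // min_r ?yk_le // ltr_nat.
apply: ler_sum => j _; have [jk|kj] := ltnP j k; first by rewrite eq_k.
by rewrite [leRHS]min_r ?yk_le // ge_min lexx orbT.
Qed.

End Lexicographic.

(** * The algorithm *)

Section Argmax.
Context {R : realType} {n : nat} {G : finType}.
Context {phi : bundles n G -> 'I_n -> R -> R}.
Implicit Types (X : bundles n G) (A : {set 'I_n}) (d : R).
Local Open Scope ring_scope.

Lemma gain_ge X A d k : k \in A -> ((phi X k d)%:E <= gain phi X A d)%E.
Proof. by move=> kA; apply: le_bigmax_cond. Qed.

Lemma first_argmaxP X A d i : first_argmax phi X A d i ->
  forall k, k \in A -> phi X k d <= phi X i d.
Proof. by move=> [_ iE _] k kA; have := gain_ge X d kA; rewrite -iE lee_fin. Qed.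

Lemma first_argmax_exists X A d : A != set0 -> exists i, first_argmax phi X A d i.
Proof.
case/set0Pn => i0 i0A; have [i1 i1A i1max] := @arg_maxP _ _ _ i0 [in A] (fun k => phi X k d) i0A.
have i1E : (phi X i1 d)%:E = gain phi X A d.
  apply/eqP; rewrite eq_le gain_ge //=; apply/bigmax_leP; split=> [|k kA].
    exact: leNye.
  by rewrite lee_fin; apply: i1max.
pose P k := (k \in A) && ((phi X k d)%:E == gain phi X A d).
have Pi1 : P i1 by rewrite /P i1E eqxx andbT.
case: (@arg_minnP _ i1 P (@nat_of_ord n) Pi1) => i /andP[iA /eqP iE] imin.
by exists i; split=> // k kA /eqP kE; apply: imin; rewrite /P kA.
Qed.

End Argmax.

(** * Invariant of the run, progress and termination *)

Section Run.
Context {R : realType} {n : nat} {G : finType} {c : nat}.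
Context {v : 'I_n -> {set G} -> R}.
Hypotheses (c_ge2 : 2 <= c) (v_SUB : forall i : 'I_n, one_c_SUB c (v i)).
Implicit Types (X Y : bundles n G) (Z : {ffun 'I_n -> {set G}}) (s t : @state n G).
Implicit Types (i k h : 'I_n) (K L w : nat).

Let betaP j := beta_rank c_ge2 v_SUB j.
Let phi := leximin_gain c v.
Let rk Y i := beta c v (Some i) (Y (Some i)).
Let size_of X i := #|X (Some i)|.

Definition capped_maximal X K := forall Y, is_allocation Y ->
  capped_sum (rk Y) K <= capped_sum (size_of X) K.

Lemma capped_maximal_mono X X' K : (forall i, size_of X i <= size_of X' i) ->
  capped_maximal X K -> capped_maximal X' K.
Proof.
move=> leX maxX Y /maxX /leq_trans; apply; apply: leq_sum => i _.
by have := leX i; lia.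
Qed.

(** Agents with a path hold [K], the largest capped value; for the others the cap is idle in [X] and
    [tight] applies. *)
Lemma no_path_maximal X K : clean c v X -> (forall i, size_of X i <= K) ->
  (forall i, size_of X i = K \/ no_path c v X i) -> capped_maximal X K.
Proof.
move=> clX leK npK Y alY; rewrite /capped_sum.
rewrite (bigID (no_path c v X)) [X in _ <= X](bigID (no_path c v X)) /=.
apply: leq_add.
  apply: leq_trans (leq_trans (tight c_ge2 v_SUB clX alY) _); apply: leq_sum => i _.
    exact: geq_minl.
  by rewrite (minn_idPl (leK i)).
apply: leq_sum => i npi; case: (npK i) => [->|]; last by rewrite (negPf npi).
by rewrite minnn geq_minr.
Qed.

Definition utility s i := c * size_of (clean_part s) i + #|ones_part s i|.

(* Ties are broken in favour of active agents, and an active agent at the level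
   [w] forces [w] to be a multiple of [c]; this is what [level_eq] records. *)
Record at_level s w : Prop := AtLevel {
  level_le : forall i, w <= utility s i;
  level_active : forall i, i \in active s -> size_of (clean_part s) i <= (w %/ c).+1;
  level_inactive : forall i, i \notin active s ->
    size_of (clean_part s) i <= w %/ c /\ utility s i <= w.+1;
  level_eq : forall i k, i \in active s -> utility s i = w -> k \notin active s ->
    utility s k = w;
  level_max : capped_maximal (clean_part s) (w %/ c)
}.

Record invariant s : Prop := Invariant {
  inv_clean : clean c v (clean_part s);
  inv_sub : forall h, ones_part s h \subset clean_part s None;
  inv_disj : forall h k, h != k -> [disjoint ones_part s h & ones_part s k];
  inv_active : forall i, i \in active s -> ones_part s i = set0;
  inv_no_path : forall i, i \notin active s -> no_path c v (clean_part s) i;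
  inv_level : exists w, at_level s w
}.

Let c_gt0 : 0 < c. Proof. exact: ltnW. Qed.

Lemma utility_active s i : invariant s -> i \in active s ->
  utility s i = c * size_of (clean_part s) i.
Proof. by move=> inv iU; rewrite /utility (inv_active inv iU) cards0 addn0. Qed.

(** An inactive agent has no path, not even one of a single vertex, so no good of
    [clean_part s None] raises her rank. *)
Lemma output_beta s i : invariant s ->
  beta c v (Some i) (output s (Some i)) = size_of (clean_part s) i.
Proof.
move=> inv; have [_ rX] := inv_clean inv; rewrite ffunE; apply/eqP.
rewrite eqn_leq -{2}[size_of _ _]rX (rank_mono (betaP _)) ?subsetUl // andbT.
have [iU|iU] := boolP (i \in active s).
  by rewrite (inv_active inv iU) setU0 rX.
rewrite -[size_of _ _]rX; apply: (rank_span (betaP _)) => x xZ.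
have xN := subsetP (inv_sub inv i) x xZ.
rewrite -ltnS ltn_neqAle (rank_leS (betaP _)) andbT; apply/negP => xF.
have /no_pathP/(_ x [::])[] := inv_no_path inv iU.
by split=> //; rewrite inE.
Qed.

Lemma output_utility s i : invariant s ->
  v i (output s (Some i)) = (utility s i)%:R%R.
Proof.
move=> inv; have := valuation0E c_ge2 v_SUB (Some i) (output s (Some i)).
rewrite output_beta //= => ->; congr (_%:R)%R; rewrite ffunE /utility.
have [[disX _] _] := inv_clean inv.
have -> : #|clean_part s (Some i) :|: ones_part s i| =
    size_of (clean_part s) i + #|ones_part s i|.
  rewrite -cardsUI (_ : _ :&: _ = set0) ?cards0 ?addn0 //.
  apply/eqP; rewrite setI_eq0; have sZ := inv_sub inv i.
  by rewrite disjoint_sym; apply: disjointWl sZ _; apply: disX.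
by rewrite -(prednK c_gt0) mulSn /=; lia.
Qed.

Let phiE s i d : invariant s ->
  phi (output s) i d = (- (c%:R + 1) * (utility s i)%:R + d)%R.
Proof. by move=> inv; rewrite /phi /leximin_gain output_utility. Qed.

Lemma argmax_utility s A d i : invariant s -> first_argmax phi (output s) A d i ->
  forall k, k \in A -> utility s i <= utility s k.
Proof.
move=> inv /first_argmaxP argi k /argi; rewrite !phiE // => le_ik.
have : ((c.+1 * utility s i)%N%:R <= (c.+1 * utility s k)%N%:R :> R)%R.
  by rewrite !natrM -(natr1 c); lra.
by rewrite ler_nat leq_pmul2l.
Qed.

(** With utilities [x] of [i] and [y] of [k], the gains give [(c + 1) * (x - y) <= c - 1], so
    [x <= y] by integrality. *)
Lemma gain_c_utility s i k : invariant s -> (gain_1 phi s <= gain_c c phi s)%E ->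
  first_argmax phi (output s) (active s) c%:R%R i -> k \notin active s ->
  utility s i <= utility s k.
Proof.
move=> inv le_1c [_ iE _] kU.
have : ((phi (output s) k 1)%:E <= gain_1 phi s)%E by rewrite gain_ge // inE.
move=> /le_trans/(_ le_1c); rewrite /gain_c -iE lee_fin !phiE //.
move: (utility s i) (utility s k) => x y le_ki.
have : ((c.+1 * x + 1)%N%:R <= (c.+1 * y + c)%N%:R :> R)%R.
  by rewrite -[c.+1]addn1 !natrD !natrM !natrD; lra.
rewrite ler_nat; nia.
Qed.

(** Here [(c + 1) * (y - x) > c - 1], so the inequality is strict. *)
Lemma gain_1_utility s i k : invariant s -> (gain_c c phi s < gain_1 phi s)%E ->
  first_argmax phi (output s) (~: active s) 1%R i -> k \in active s ->
  utility s i < utility s k.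
Proof.
move=> inv lt_c1 [_ iE _] kU.
have : ((phi (output s) k c%:R)%:E <= gain_c c phi s)%E by rewrite gain_ge.
move=> /le_lt_trans/(_ lt_c1); rewrite /gain_1 -iE lte_fin !phiE //.
move: (utility s i) (utility s k) => x y lt_ki.
have : ((c.+1 * x + c)%N%:R < (c.+1 * y + 1)%N%:R :> R)%R.
  by rewrite -[c.+1]addn1 !natrD !natrM !natrD; lra.
rewrite ltr_nat; nia.
Qed.

(** An active agent with at most [w %/ c] clean goods would have utility at most [w], hence equal to
    [w]. So all active agents have completed the next clean level. *)
Lemma level_maxS s w : invariant s -> at_level s w ->
    (forall i, i \in active s -> utility s i <> w) ->
  (forall i, i \in active s -> size_of (clean_part s) i = (w %/ c).+1) /\
  capped_maximal (clean_part s) (w %/ c).+1.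
Proof.
move=> inv lev neU.
have eqS i : i \in active s -> size_of (clean_part s) i = (w %/ c).+1.
  move=> iU; apply/eqP; rewrite eqn_leq level_active // ltnNge; apply/negP => le_size.
  apply: (neU i iU); apply/eqP; rewrite eqn_leq level_le // andbT utility_active //.
  by rewrite (leq_trans (leq_mul (leqnn c) le_size)) // mulnC leq_divM.
split=> //; apply: no_path_maximal => [|i|i]; first exact: inv_clean.
  by have [/eqS->//|/(level_inactive lev)[/leqW]] := boolP (i \in active s).
by have [/eqS|/(inv_no_path inv)] := boolP (i \in active s); [left | right].
Qed.

(** If the minimum has passed [w], no active agent is at [w], so [level_maxS] applies. *)
Lemma level_raise s i : invariant s -> (forall k, utility s i <= utility s k) ->
  at_level s (utility s i).
Proof.
move=> inv min_i; have [w lev] := inv_level inv.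
have := level_le lev i; rewrite leq_eqVlt => /predU1P[<-//|w_lt].
have neU k : k \in active s -> utility s k <> w.
  by move=> _ kw; have := min_i k; rewrite kw leqNgt w_lt.
have [sizeS maxS] := level_maxS inv lev neU; set L := w %/ c in sizeS maxS.
have utilU k : k \in active s -> utility s k = c * L.+1.
  by move=> kU; rewrite utility_active // sizeS.
have wL : c * L <= w < c * L.+1.
  by rewrite ![c * _]mulnC leq_divM -ltn_divLR //= leqnn.
have w'_le : utility s i <= c * L.+1.
  have [/utilU-> //|/(level_inactive lev)[_ u_le]] := boolP (i \in active s).
  by apply: leq_trans u_le _; lia.
(* The quotient by [c] grows only when the new level is exactly [c * L.+1], which is where
   maximality at [L.+1] is used. *)
move: w'_le; rewrite leq_eqVlt => /predU1P[w'E|w'_lt].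
  have w'L : utility s i %/ c = L.+1 by rewrite w'E mulKn.
  split; rewrite ?w'L //.
  - by move=> k kU; rewrite sizeS // leqnSn.
  - by move=> k kU; have [le_size le_u] := level_inactive lev kU; split; lia.
  - by move=> j k jU _ kU; have [_ le_u] := level_inactive lev kU; have := min_i k; lia.
have w'L : utility s i %/ c = L.
  by apply/eqP; rewrite eqn_leq -ltnS ltn_divLR // leq_divRL // ![_ * c]mulnC; lia.
split; rewrite ?w'L //.
- by move=> k kU; rewrite sizeS.
- by move=> k kU; have [le_size le_u] := level_inactive lev kU; split; lia.
- by move=> j k jU jw'; move: w'_lt; rewrite -jw' utilU // ltnn.
- exact: level_max lev.
Qed.

Lemma free_goodsP X Z g :
  reflect (g \in X None /\ forall h, g \notin Z h) (g \in free_goods X Z).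
Proof.
rewrite inE andbC; apply: (iffP andP) => -[gN gZ]; split=> //.
  by move=> h; apply: contra gZ => gh; apply/bigcupP; exists h.
by apply/bigcupP => -[h _]; apply/negP.
Qed.

Lemma free_goods_exists X Z : \sum_h #|Z h| < #|X None| -> exists g, g \in free_goods X Z.
Proof.
move=> lt_ZX; apply/set0Pn; rewrite setD_eq0; apply: contraL lt_ZX => sXZ.
rewrite -leqNgt (leq_trans (subset_leq_card sXZ)) //.
elim/big_rec2: _ => [|h a A _ le_Aa]; first by rewrite cards0.
by rewrite (leq_trans (leq_card_setU _ _)) // leq_add2l.
Qed.

Lemma refill_ones X Y Z x Z' : Y None = X None :\ x ->
    (forall h, Z h \subset X None) ->
    (forall h k, h != k -> [disjoint Z h & Z k]) -> refill Y Z x Z' ->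
  [/\ forall h, #|Z' h| = #|Z h|, forall h, Z' h \subset Y None
    & forall h k, h != k -> [disjoint Z' h & Z' k]].
Proof.
move=> YN sZX disZ [[h [g [xh /free_goodsP[gN gZ] ->]]] | [xZ ->]]; last first.
  by split=> // h; rewrite YN subsetD1 sZX xZ.
have Z'E k y : y \in [ffun k => if k == h then g |: Z h :\ x else Z k] k ->
    (y \in Z k /\ y != x) \/ (y = g /\ k = h).
  rewrite ffunE; case: eqP => [->|/eqP kh]; rewrite ?inE.
    by case/predU1P => [->|/andP[yx yh]]; [right | left].
  move=> yk; left; split=> //; apply: contraNneq kh => yx.
  by apply: contraT => /disZ dis; have := disjointFr dis yk; rewrite yx xh.
split=> [k|k|k k' kk'].
- rewrite ffunE; case: eqP => [->|] //.
  by rewrite cardsU1 !inE (negPf (gZ h)) andbF [RHS](cardsD1 x) xh.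
- apply/subsetP => y /Z'E[[yk yx]|[-> _]] //.
  by rewrite YN !inE yx (subsetP (sZX k)).
apply/pred0P => y; apply/negP => /andP[/Z'E yk /Z'E yk'].
case: yk yk' => [[yk _]|[yg kh]] [[yk' _]|[yg' kh']].
- by move: (disjointFr (disZ _ _ kk') yk); rewrite yk'.
- by move: (gZ k); rewrite -yg' yk.
- by move: (gZ k'); rewrite -yg yk'.
- by rewrite kh kh' eqxx in kk'.
Qed.

(** The loop guard supplies a free good of [X]; if [x] is in some [Z h], that good differs from [x]
    and stays free in [Y]. *)
Lemma refill_exists X Y Z x : Y None = X None :\ x -> x \in X None ->
  \sum_h #|Z h| < #|X None| -> exists Z', refill Y Z x Z'.
Proof.
move=> YN xN /free_goods_exists[g /free_goodsP[gN gZ]].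
have [/existsP[h xh]|xZ] := boolP [exists h, x \in Z h]; last first.
  exists Z; right; split=> // h; apply: contra xZ => xh.
  by apply/existsP; exists h.
eexists; left; exists h, g; split=> //; apply/free_goodsP; split=> //.
by rewrite YN !inE gN andbT; apply: contraNneq (gZ h) => ->.
Qed.

Lemma sum_ones s : invariant s ->
  \sum_h #|ones_part s h| = #|\bigcup_h ones_part s h|.
Proof.
move=> inv; rewrite -sum1_card partition_disjoint_bigcup; last exact: inv_disj.
by apply: eq_bigr => h _; rewrite sum1_card.
Qed.

Lemma sum_ones_le s : invariant s ->
  \sum_h #|ones_part s h| <= #|clean_part s None|.
Proof.
move=> inv; rewrite sum_ones // subset_leq_card //; apply/bigcupsP => h _.
exact: inv_sub.
Qed.

Lemma output_allocation s : invariant s -> is_allocation (output s).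
Proof.
move=> inv; have [alX _] := inv_clean inv; apply/allocationP => x.
have outE i : (x \in output s (Some i)) =
    (x \in clean_part s (Some i)) || (x \in ones_part s i).
  by rewrite ffunE inE.
have outN : (x \in output s None) =
    ~~ [exists i, (x \in clean_part s (Some i)) || (x \in ones_part s i)].
  rewrite ffunE inE; congr (~~ _); apply/bigcupP/existsP => [[i _]|[i xi]].
    by rewrite inE; exists i.
  by exists i; rewrite ?inE.
have [/existsP[k xk]|xN] := boolP [exists i, x \in output s (Some i)]; last first.
  exists None => -[i|]; first by apply/negbTE; apply: contra xN => xi; apply/existsP; exists i.
  rewrite outN eqxx; apply: contra xN => /existsP[i]; rewrite -outE => xi.
  by apply/existsP; exists i.
exists (Some k) => -[i|]; last first.
  by rewrite outN; apply/negbTE/negPn/existsP; exists k; rewrite -outE.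
have [[->]|ne] := eqVneq (Some i) (Some k); first by rewrite xk.
apply/negbTE/negP; move: xk; rewrite !outE.
case/orP => xk /orP[] xi.
- by have := alloc_uniq alX xk xi => ki; rewrite ki eqxx in ne.
- by have := alloc_uniq alX xk (subsetP (inv_sub inv i) x xi).
- by have := alloc_uniq alX xi (subsetP (inv_sub inv k) x xk).
have ik : i != k by apply: contra ne => /eqP ->.
by have := disjointFr (inv_disj inv ik) xi; rewrite xk.
Qed.

(** A competing [Y] is split like the output: [rk Y i] goods worth [c] and the rest worth 1. *)
Lemma output_leximin s : invariant s -> ~~ running s -> leximin v (output s).
Proof.
move=> inv stop; split=> [|Y alY]; first exact: output_allocation.
have [alX _] := inv_clean inv; have [w lev] := inv_level inv.
have vY i : v i (Y (Some i)) = (c * rk Y i + (#|Y (Some i)| - rk Y i))%N%:R%R.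
  have := valuation0E c_ge2 v_SUB (Some i) (Y (Some i)) => /= ->; congr (_%:R)%R.
  rewrite -/(rk Y i); have := rank_le_card (betaP (Some i)) (Y (Some i)).
  by rewrite -/(rk Y i) -(prednK c_gt0) mulSn /=; lia.
case/(lex_dominates_capped (fun i => output_utility i inv) vY) => th [eq_th].
rewrite ltnNge => /negP; apply.
apply: (@capped_not_dominated _ c w #|G| (size_of (clean_part s))
  (fun i => #|ones_part s i|) (rk Y) _ (active s)) => //.
- exact: level_le lev.
- by move=> i iU; rewrite (inv_active inv iU) cards0 (level_active lev).
- exact: level_inactive lev.
- exact: level_eq lev.
- exact: (level_max lev alY).
- by move=> /(level_maxS inv lev)[_]; apply.
(* The stopped loop has handed out every good left by the clean part. *)
- rewrite big_split /= -(sum_card_alloc alX); congr (_ + _).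
  by apply/eqP; rewrite eqn_leq sum_ones_le // leqNgt.
rewrite -(sum_card_alloc alY) (leq_trans _ (leq_addr _ _)) //; apply: leq_sum => i _.
by rewrite subnKC // rank_le_card.
Qed.

Lemma init_invariant : invariant (@init n G).
Proof.
have alX : is_allocation (clean_part (@init n G)).
  apply/allocationP => x; exists None => -[i|]; by rewrite ffunE inE.
split=> /= [|h|h k _|i _|i|].
- split=> // -[i|] /=; last by rewrite (beta_None c_ge2 v_SUB).
  by rewrite ffunE cards0 (rank_set0 (betaP _)).
- by rewrite ffunE sub0set.
- by rewrite !ffunE -setI_eq0 set0I.
- by rewrite ffunE.
- by rewrite inE.
exists 0; rewrite /= ; split=> //=; rewrite ?div0n.
- by move=> i _; rewrite /size_of ffunE cards0.
- by move=> i; rewrite inE.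
- by move=> i k _ _; rewrite inE.
by move=> Y _; rewrite /capped_sum big1 // => i _; rewrite minn0.
Qed.

(** The served agent has least utility, so the level is first raised to her utility before the step,
    and the step respects it. *)
Lemma step_invariant s t : invariant s -> step c v phi s t -> invariant t.
Proof.
move=> inv; have [clX sZX disZ ZU npU _] := inv.
case=> [i g p Z' run le_gain argi sp refZ | i run le_gain argi nopath | i g run lt_gain argi gfree].
- have iU : i \in active s by case: argi.
  have lev : at_level s (utility s i).
    apply: level_raise => // k; have [kU|kU] := boolP (k \in active s).
      exact: argmax_utility argi _ kU.
    exact: gain_c_utility argi kU.
  have [cZ sZ' disZ'] := refill_ones (augment_None c_ge2 clX sp) sZX disZ refZ.
  have size' k : size_of (augment (clean_part s) i g p) k = size_of (clean_part s) k + (k == i).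
    exact: (augment_card c_ge2 v_SUB clX sp).
  have u' k : c * size_of (augment (clean_part s) i g p) k + #|Z' k| = utility s k + c * (k == i).
    by rewrite size' cZ mulnDr addnAC.
  have wE := utility_active inv iU; have wL : utility s i %/ c = size_of (clean_part s) i.
    by rewrite wE mulKn.
  split=> //= [|k kU|k kU|].
  + exact: (augment_clean c_ge2 v_SUB clX sp).
  + by apply/eqP; rewrite -cards_eq0 cZ ZU // cards0.
  + exact: (no_path_augment c_ge2 v_SUB clX sp (npU k kU)).
  exists (utility s i); split=> /=; rewrite /utility /=.
  + by move=> k; rewrite u' (leq_trans (level_le lev k)) // leq_addr.
  + move=> k kU; rewrite size'; case: eqP => [->|_]; first by rewrite wL addn1.
    by rewrite addn0 (level_active lev).
  + move=> k kU; rewrite u' size'; case: eqP => [ki|_]; first by rewrite ki iU in kU.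
    by rewrite muln0 !addn0; apply: level_inactive lev _ kU.
  + move=> j k jU _ kU; rewrite u'; case: eqP => [ki|_]; first by rewrite ki iU in kU.
    by rewrite muln0 addn0; apply: (level_eq lev iU).
  by apply: capped_maximal_mono (level_max lev) => k; rewrite size' leq_addr.
- have iU : i \in active s by case: argi.
  have lev : at_level s (utility s i).
    apply: level_raise => // k; have [kU|kU] := boolP (k \in active s).
      exact: argmax_utility argi _ kU.
    exact: gain_c_utility argi kU.
  have wL : utility s i %/ c = size_of (clean_part s) i.
    by rewrite (utility_active inv iU) mulKn.
  have inD k : k \notin active s :\ i -> k = i \/ k \notin active s.
    by rewrite !inE negb_and negbK => /predU1P.
  split=> //= [k|k /inD[->|/npU //]|]; first by rewrite inE => /andP[_ /ZU].
    exact/no_pathP.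
  exists (utility s i); split=> /=.
  + exact: level_le lev.
  + by move=> k; rewrite inE => /andP[_ /(level_active lev)].
  + by move=> k /inD[->|/(level_inactive lev)//]; rewrite wL leqnn.
  (* The deactivated agent was active at the level, which already put every inactive agent there. *)
  + move=> j k _ _ /inD[-> //|kU].
    exact: (level_eq lev iU erefl kU).
  exact: level_max lev.
have iU : i \notin active s by case: argi; rewrite inE.
have lev : at_level s (utility s i).
  apply: level_raise => // k; have [kU|kU] := boolP (k \in active s).
    exact/ltnW/(gain_1_utility inv lt_gain argi kU).
  by apply: argmax_utility argi _ _ => //; rewrite inE.
have gtU k : k \in active s -> utility s i < utility s k.
  exact: gain_1_utility.
have [gN gZ] := free_goodsP _ _ _ gfree.
set Z' := finfun _.
have Z'E k : Z' k = if k == i then g |: ones_part s i else ones_part s k.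
  by rewrite ffunE.
have cZ' k : #|Z' k| = #|ones_part s k| + (k == i).
  rewrite Z'E; case: eqP => [->|_]; last by rewrite addn0.
  by rewrite cardsU1 gZ addnC.
have u' k : utility (State (clean_part s) Z' (active s)) k = utility s k + (k == i).
  by rewrite /utility /= cZ' addnA.
split=> //= [h|h k hk|k kU|].
- by rewrite Z'E; case: eqP => _ //; rewrite subUset sub1set gN sZX.
- rewrite !Z'E; apply/pred0P => y /=; apply/negP => /andP[].
  case: eqP => [hi|_]; case: eqP => [ki|_].
  + by rewrite hi ki eqxx in hk.
  + move=> /setU1P[->|yi] yk; first by move: (gZ k); rewrite yk.
    by have := disjointFr (disZ _ _ hk); rewrite hi => /(_ _ yi); rewrite yk.
  + move=> yh /setU1P[yg|yi]; first by move: (gZ h); rewrite -yg yh.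
    by have := disjointFr (disZ _ _ hk) yh; rewrite ki yi.
  by move=> yh yk; have := disjointFr (disZ _ _ hk) yh; rewrite yk.
- by rewrite Z'E; case: eqP => [ki|_]; [rewrite ki (negPf iU) in kU | apply: ZU].
exists (utility s i); split.
- by move=> k; rewrite u' (leq_trans (level_le lev k)) // leq_addr.
- exact: level_active lev.
- move=> k kU; have [le_size le_u] := level_inactive lev kU; split=> //.
  by rewrite u'; case: eqP => [->|_]; rewrite ?addn1 ?addn0.
(* Vacuous: all active agents are strictly above the level. *)
- move=> j k jU; rewrite u' => uj; have := gtU j jU; lia.
exact: level_max lev.
Qed.

Lemma reachable_invariant s : reachable c v phi s -> invariant s.
Proof.
elim=> [|{}s t _ inv st]; first exact: init_invariant.
exact: step_invariant inv st.
Qed.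

Lemma step_exists s : 0 < n -> invariant s -> running s ->
  exists t, step c v phi s t.
Proof.
move=> n_gt0 inv run; have [clX sZX disZ _ _ _] := inv.
have gain0 d : gain phi (output s) set0 d = -oo%E by rewrite /gain big_set0.
have [le_gain|lt_gain] := leP (gain_1 phi s) (gain_c c phi s).
  (* With no active agent, [gain_c] would be [-oo], while [gain_1] ranges over all agents and is
     finite because [0 < n]. *)
  have U0 : active s != set0.
    apply: contraTneq le_gain => U0; rewrite /gain_c U0 gain0 -ltNge.
    rewrite /gain_1 U0; pose i := Ordinal n_gt0.
    apply: lt_le_trans (gain_ge (output s) _ (_ : i \in _)); first exact: ltNyr.
    by rewrite !inE.
  have [i argi] := @first_argmax_exists _ _ _ phi (output s) _ c%:R%R U0.
  have [npi|] := boolP (no_path c v (clean_part s) i).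
    by eexists; apply: step_deactivate argi _ => //; apply/no_pathP.
  case/exists_shortest => g [p sp].
  have [[_ _ lastp] _] := sp.
  have [Z' refZ] := refill_exists (augment_None c_ge2 clX sp) lastp run.
  by eexists; apply: step_swap argi sp refZ.
have U0 : ~: active s != set0.
  by apply: contraTneq lt_gain => U0; rewrite /gain_1 U0 gain0 -leNgt leNye.
have [i argi] := @first_argmax_exists _ _ _ phi (output s) _ 1%R U0.
have [g gfree] := free_goods_exists run.
by eexists; apply: step_one argi gfree.
Qed.

(** A swap lowers the first two terms, a step handing out a good worth 1 the second, a deactivation
    the third. *)
Definition measure s :=
  #|clean_part s None| + (#|clean_part s None| - \sum_h #|ones_part s h|) + #|active s|.

Lemma step_measure s t : invariant s -> step c v phi s t -> measure t < measure s.
Proof.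
move=> inv; have [clX sZX disZ _ _ _] := inv.
case=> [i g p Z' run le_gain argi sp refZ | i run le_gain argi nopath | i g run lt_gain argi gfree].
- have [cZ _ _] := refill_ones (augment_None c_ge2 clX sp) sZX disZ refZ.
  have [[_ _ lastp] _] := sp.
  rewrite /measure /= (eq_bigr _ (fun h _ => cZ h)) (augment_None c_ge2 clX sp).
  by move: run; rewrite /running [#|clean_part s None|](cardsD1 (last g p)) lastp; lia.
- have [iU _ _] := argi; by rewrite /measure /= ltn_add2l [X in _ < X](cardsD1 i) iU.
have [_ gZ] := free_goodsP _ _ _ gfree.
set Z' := finfun _.
have sumZ' : \sum_h #|Z' h| = (\sum_h #|ones_part s h|).+1.
  rewrite (bigD1 i) //= [in RHS](bigD1 i) //= ffunE eqxx cardsU1 gZ -addSn; congr (_ + _).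
  by apply: eq_bigr => h /negPf hi; rewrite ffunE hi.
by move: run; rewrite /running /measure /= sumZ' ltn_add2r ltn_add2l => run; rewrite ltn_sub2l.
Qed.

Lemma invariant_acc s : invariant s -> Acc (fun t s => step c v phi s t) s.
Proof.
have [k] := ubnP (measure s); elim: k s => [|k IHk] s; first by rewrite ltn0.
rewrite ltnS => le_k inv; constructor=> t st.
by apply: (IHk t); [apply: leq_trans (step_measure inv st) le_k | apply: step_invariant st].
Qed.

End Run.

Unset Implicit Arguments.

Theorem theorem6p2 (R : realType) (n : nat) (G : finType) (c : nat)
    (v : 'I_n -> {set G} -> R)
    (n_gt0 : 0 < n) (c_ge2 : 2 <= c)
    (v_SUB : forall i : 'I_n, one_c_SUB c (v i)) :
  yankee_swap_computes c v (leximin_gain c v) (leximin v).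
Proof.
split=> [|s /(reachable_invariant c_ge2 v_SUB) inv].
  exact/(invariant_acc c_ge2 v_SUB)/init_invariant.
case: ifPn => [run|stop]; first exact: (step_exists c_ge2).
exact: (output_leximin c_ge2 v_SUB).
Qed.
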